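(* Let $(b_k)_{k\ge 1}$ and $(d_k)_{k\ge 1}$ be the real coefficients for which $$\left(1+\frac{1}{x}\right)^x = e\left(1-\sum_{k=1}^{\infty}\frac{b_k}{(1+x)^k}\right) = e\left(1-\sum_{k=1}^{\infty}\frac{d_k}{\left(x+\tfrac{11}{12}\right)^k}\right),\qquad x>0,$$ and for each integer $m\ge 1$ and real $x>0$ define the partial sums $$\sigma_m(x):=\sum_{k=1}^{m}\frac{b_k}{(1+x)^k},\qquad S_m(x):=\sum_{k=1}^{m}\frac{d_k}{\left(x+\tfrac{11}{12}\right)^k}.$$ Then $S_m(x)>\sigma_m(x)$ for all real $x>0$ and all integers $m\ge 1$.
   Context: Explicitly, the coefficients are given as follows. Let $g:[0,1]\to\mathbb{R}$ be $g(s)=\frac{1}{\pi}s^s(1-s)^{1-s}\sin(\pi s)$ for $0<s<1$ and $g(0)=g(1)=0$. Then $b_1=\tfrac12$ and $b_{n+1}=\frac{1}{n+1}\left(\frac{1}{n+2}-\sum_{j=1}^{n}\frac{b_j}{n+2-j}\right)$ for $n\ge1$; equivalently $e\,b_k=\int_0^1 g(s)s^{k-2}\,ds$ for $k\ge 2$ (so $b_2=\tfrac1{24}$, $b_3=\tfrac1{48}$, $b_4=\tfrac{73}{5670}$). Also $d_1=\tfrac12$ and $d_n=\frac{1}{12^{n-1}e}\left((-1)^{n-1}+\int_0^1\frac{(12t-1)^{n-1}}{t}g(t)\,dt\right)$ for $n\ge 2$ (so $d_2=0$, $d_3=\tfrac{5}{288}$, $d_4=\tfrac{139}{17280}$). Here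 $e$ is Euler's number. *)

(* Defs.v *)
From Stdlib Require Import Reals List.
From Coquelicot Require Import Coquelicot.
Import ListNotations.
Open Scope R_scope.

Definition g (s : R) : R :=
  if Rlt_dec 0 s then
    if Rlt_dec s 1 then
      / PI * Rpower s s * Rpower (1 - s) (1 - s) * sin (PI * s)
    else 0
  else 0.

(* next value of the recurrence given the list l = [b_1; ...; b_(m)] :
   m = 0 gives b_1 = 1/2;  m = n+1 gives
   b_(n+2) = 1/(n+2) * (1/(n+3) - sum_(j=1)^(n+1) b_j/(n+3-j)). *)
Definition b_next (m : nat) (l : list R) : R :=
  match m with
  | O => / 2
  | S n => / (INR n + 2) *
           (/ (INR n + 3) -
            sum_f_R0 (fun i => nth i l 0 / INR (n + 2 - i)) n)
  end.

Fixpoint blist (k : nat) : list R :=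
  match k with
  | O => []
  | S m => blist m ++ [b_next m (blist m)]
  end.

(* b k = b_k for k >= 1 (b 0 is an irrelevant default). *)
Definition b (k : nat) : R := nth (k - 1) (blist k) 0.

Definition d (n : nat) : R :=
  match n with
  | 1%nat => / 2
  | _ => / (12 ^ (n - 1) * exp 1) *
         ((-1) ^ (n - 1) + RInt (fun t => (12 * t - 1) ^ (n - 1) / t * g t) 0 1)
  end.

Definition sigma_m (m : nat) (x : R) : R :=
  sum_f_R0 (fun i => b (S i) / (1 + x) ^ (S i)) (m - 1).

Definition S_m (m : nat) (x : R) : R :=
  sum_f_R0 (fun i => d (S i) / (x + 11 / 12) ^ (S i)) (m - 1).

Lemma b2_check : b 2 = / 24.
Proof. unfold b; simpl. rewrite Rplus_0_l. replace (INR 0) with 0 by reflexivity. simpl. field. Qed.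

(* Main.v *)
Require Import Defs.
From Stdlib Require Import Reals Lra Lia List Arith.
From Coquelicot Require Import Coquelicot.
Open Scope R_scope.

(** Let [mu] be the measure [delta_0 + g(s)/s ds] on [0, 1]. Then [e b_k] and [e d_k] are the
    [mu]-integrals of [s^(k-1)] and [(s - 1/12)^(k-1)]. For [b] this is a residue computation:
    [(z / (z - 1))^(z - 1)] is holomorphic off the slit [0, 1], its jump across the slit is
    given by [g(s)/s], and at infinity its logarithmic derivative yields the recurrence of
    the [b_k]. The contours are confocal ellipses, shrinking to the slit on one side and
    growing to infinity on the other.

    With [y = 1 + x] and [u = y - 1/12], summing the geometric series writes [e (S_m - sigma_m)]
    as the [mu]-integral of [((s/y)^m - ((s - 1/12)/u)^m) / (y - s)]. For odd [m] the integrand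
    is nonnegative. For even [m] it is negative near [0], but it is bounded below by a positive
    multiple of a quadratic polynomial in [s], whose [mu]-integral is positive by the values of
    [b_1], [b_2], [b_3]. *)

(** * Holomorphic functions on a half plane *)

(** The substitution [z = (1 + cos tau) / 2] with [tau = t + i r] maps the half strip [0 < t < PI],
    [r > 0] onto the lower half plane. In these coordinates the logarithm of [z / (z - 1)] has
    explicit real and imaginary parts, so no branch has to be followed, and Cauchy's theorem becomes
    the constancy in [r] of an integral over the fixed interval from [0] to [PI]. Half of each
    ellipse is enough because the form is real along the real axis outside the slit: only the
    imaginary part of the integral matters. The obstacle sits at the two ends of the slit. The
    logarithm is unbounded at [z = 0] and [z = 1], so convergence to the boundary values is uniform
    by compactness only away from them, and separate estimates are needed there. Moreover
    [z (z / (z - 1))^(z - 1)] tends to [-1] at [z = 0], which would leave a pole after division by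
    [z]; adding [1] removes this pole, and the correction reappears as the atom [delta_0] of
    [mu]. *)

Definition cexp (z : C) : C := (exp (Re z) * cos (Im z), exp (Re z) * sin (Im z)).

Lemma cexp_plus (a b : C) : cexp (a + b) = (cexp a * cexp b)%C.
Proof.
  destruct a, b; unfold cexp; apply injective_projections; simpl;
    rewrite exp_plus, ?cos_plus, ?sin_plus; ring.
Qed.

Lemma cexp_0 : cexp 0 = 1.
Proof.
  unfold cexp; simpl; rewrite exp_0, cos_0, sin_0.
  apply injective_projections; simpl; ring.
Qed.

Lemma cexp_opp_r (a : C) : (cexp a * cexp (- a) = 1)%C.
Proof. rewrite <- cexp_plus, Cplus_opp_r; apply cexp_0. Qed.

Lemma Cmod_cexp (a : C) : Cmod (cexp a) = exp (Re a).
Proof.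
  unfold Cmod, cexp; simpl.
  replace (_ + _) with (exp (Re a) * exp (Re a) * (Rsqr (sin (Im a)) + Rsqr (cos (Im a))))
    by (unfold Rsqr; ring).
  rewrite sin2_cos2, Rmult_1_r; apply sqrt_square, Rlt_le, exp_pos.
Qed.

(** Componentwise, so that the real chain rule, mean value theorem and integration lemmas apply
    directly to each part. *)
Definition is_cderive (f : R -> C) (x : R) (l : C) : Prop :=
  is_derive (fun t => Re (f t)) x (Re l) /\ is_derive (fun t => Im (f t)) x (Im l).

Lemma is_cderive_const (c : C) (x : R) : is_cderive (fun _ => c) x 0.
Proof. split; apply @is_derive_const. Qed.

Lemma is_cderive_ext (f g : R -> C) (x : R) (l : C) :
  (forall t, f t = g t) -> is_cderive f x l -> is_cderive g x l.
Proof.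
  intros E [H1 H2]; split; [eapply is_derive_ext, H1 | eapply is_derive_ext, H2];
    intros t; simpl; now rewrite E.
Qed.

Lemma is_cderive_plus (f g : R -> C) (x : R) (lf lg : C) :
  is_cderive f x lf -> is_cderive g x lg ->
  is_cderive (fun t => f t + g t)%C x (lf + lg)%C.
Proof.
  intros [F1 F2] [G1 G2]; split.
  - exact (is_derive_plus _ _ _ _ _ F1 G1).
  - exact (is_derive_plus _ _ _ _ _ F2 G2).
Qed.

Lemma is_cderive_mult (f g : R -> C) (x : R) (lf lg : C) :
  is_cderive f x lf -> is_cderive g x lg ->
  is_cderive (fun t => f t * g t)%C x (lf * g x + f x * lg)%C.
Proof.
  intros [F1 F2] [G1 G2]; split; simpl.
  - evar_last.
    + apply (is_derive_minus (fun t => Re (f t) * Re (g t)) (fun t => Im (f t) * Im (g t))).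
      * apply (is_derive_mult _ _ _ _ _ F1 G1); intros; apply Rmult_comm.
      * apply (is_derive_mult _ _ _ _ _ F2 G2); intros; apply Rmult_comm.
    + unfold minus, plus, opp, mult; simpl; unfold Re, Im; ring.
  - evar_last.
    + apply (is_derive_plus (fun t => Re (f t) * Im (g t)) (fun t => Im (f t) * Re (g t))).
      * apply (is_derive_mult _ _ _ _ _ F1 G2); intros; apply Rmult_comm.
      * apply (is_derive_mult _ _ _ _ _ F2 G1); intros; apply Rmult_comm.
    + unfold minus, plus, opp, mult; simpl; unfold Re, Im; ring.
Qed.

Lemma Cneq0_norm (z : C) : z <> 0 -> Re z ^ 2 + Im z ^ 2 <> 0.
Proof.
  intros H E; apply H; apply injective_projections; unfold Re, Im in E; simpl in *; nra.
Qed.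

Lemma is_cderive_inv (f : R -> C) (x : R) (l : C) :
  f x <> 0 -> is_cderive f x l ->
  is_cderive (fun t => / f t)%C x (- l * (/ f x * / f x))%C.
Proof.
  intros Hx [F1 F2]; pose proof (Cneq0_norm _ Hx) as N.
  assert (D : is_derive (fun t => Re (f t) ^ 2 + Im (f t) ^ 2) x
                (2 * (Re (f x) * Re l + Im (f x) * Im l))).
  { evar_last.
    - apply (is_derive_plus (fun t => Re (f t) ^ 2) (fun t => Im (f t) ^ 2));
        [apply (is_derive_pow _ 2 _ _ F1) | apply (is_derive_pow _ 2 _ _ F2)].
    - unfold plus; simpl; ring. }
  split; simpl.
  - evar_last.
    + apply (is_derive_div _ _ _ _ _ F1 D N).
    + unfold Re, Im in *; simpl; field; simpl in N; contradict N; nra.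
  - evar_last.
    + apply (is_derive_div (fun t => - Im (f t)) _ _ _ _ (is_derive_opp _ _ _ F2) D N).
    + unfold Re, Im, opp in *; simpl; field; simpl in N; contradict N; nra.
Qed.

Lemma is_cderive_cexp (f : R -> C) (x : R) (l : C) :
  is_cderive f x l -> is_cderive (fun t => cexp (f t)) x (l * cexp (f x))%C.
Proof.
  intros [F1 F2].
  assert (E : is_derive (fun t => exp (Re (f t))) x (Re l * exp (Re (f x))))
    by exact (is_derive_comp exp _ _ _ _ (is_derive_exp _) F1).
  assert (Co : is_derive (fun t => cos (Im (f t))) x (Im l * - sin (Im (f x))))
    by exact (is_derive_comp cos _ _ _ _ (is_derive_cos _) F2).
  assert (Si : is_derive (fun t => sin (Im (f t))) x (Im l * cos (Im (f x))))
    by exact (is_derive_comp sin _ _ _ _ (is_derive_sin _) F2).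
  split; simpl.
  - evar_last. apply (is_derive_mult _ _ _ _ _ E Co); intros; apply Rmult_comm.
    unfold plus, mult; simpl; unfold Re, Im; ring.
  - evar_last. apply (is_derive_mult _ _ _ _ _ E Si); intros; apply Rmult_comm.
    unfold plus, mult; simpl; unfold Re, Im; ring.
Qed.

(** Joint continuity in [(r, t)] is what differentiation under the integral sign and uniform
    continuity on a rectangle require. *)
Definition cont2 (f : R -> R -> C) (x y : R) : Prop :=
  continuity_2d_pt (fun u v => Re (f u v)) x y /\
  continuity_2d_pt (fun u v => Im (f u v)) x y.

Lemma cont2_const (c : C) (x y : R) : cont2 (fun _ _ => c) x y.
Proof. split; apply continuity_2d_pt_const. Qed.

Lemma cont2_plus (f g : R -> R -> C) (x y : R) :
  cont2 f x y -> cont2 g x y -> cont2 (fun u v => f u v + g u v)%C x y.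
Proof. intros [] []; split; now apply continuity_2d_pt_plus. Qed.

Lemma cont2_mult (f g : R -> R -> C) (x y : R) :
  cont2 f x y -> cont2 g x y -> cont2 (fun u v => f u v * g u v)%C x y.
Proof.
  intros [] []; split.
  - apply (continuity_2d_pt_minus (fun u v => Re (f u v) * Re (g u v))
             (fun u v => Im (f u v) * Im (g u v))); now apply continuity_2d_pt_mult.
  - apply (continuity_2d_pt_plus (fun u v => Re (f u v) * Im (g u v))
             (fun u v => Im (f u v) * Re (g u v))); now apply continuity_2d_pt_mult.
Qed.

Lemma cont2_inv (f : R -> R -> C) (x y : R) :
  f x y <> 0 -> cont2 f x y -> cont2 (fun u v => / f u v)%C x y.
Proof.
  intros N [F1 F2]; apply Cneq0_norm in N.
  assert (D : continuity_2d_pt (fun u v => / (Re (f u v) ^ 2 + Im (f u v) ^ 2)) x y).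
  { apply continuity_2d_pt_inv; [ | exact N].
    apply (continuity_2d_pt_ext (fun u v => Re (f u v) * Re (f u v) + Im (f u v) * Im (f u v)));
      [intros; ring | ].
    now apply continuity_2d_pt_plus; apply continuity_2d_pt_mult. }
  split; simpl; apply continuity_2d_pt_mult; try assumption.
  now apply continuity_2d_pt_opp.
Qed.

Lemma continuity_2d_pt_comp1 (g : R -> R) (f : R -> R -> R) (x y : R) :
  continuous g (f x y) -> continuity_2d_pt f x y -> continuity_2d_pt (fun u v => g (f u v)) x y.
Proof.
  intros Hg Hf; apply continuity_1d_2d_pt_comp; [ | exact Hf].
  now apply continuity_pt_filterlim.
Qed.

Lemma cont2_cexp (f : R -> R -> C) (x y : R) :
  cont2 f x y -> cont2 (fun u v => cexp (f u v)) x y.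
Proof.
  intros [F1 F2]; split; simpl; apply continuity_2d_pt_mult.
  all: apply continuity_2d_pt_comp1; try assumption;
    solve [apply continuous_exp | apply continuous_cos | apply continuous_sin].
Qed.

(* [f] stands for a holomorphic function of [tau = t + i r] in the half plane [r > 0]:
   [d/dr = i d/dt]. *)
Definition holomorphic (f : R -> R -> C) : Prop :=
  exists f' : R -> R -> C, forall r t, 0 < r ->
    is_cderive (fun t => f r t) t (f' r t) /\
    is_cderive (fun r => f r t) r (Ci * f' r t)%C /\
    cont2 f r t /\ cont2 f' r t.

Lemma holomorphic_const (c : C) : holomorphic (fun _ _ => c).
Proof.
  exists (fun _ _ => 0); intros r t _.
  split; [ | split; [ | split]]; try apply cont2_const.
  - apply is_cderive_const.
  - rewrite Cmult_0_r; apply is_cderive_const.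
Qed.

Lemma holomorphic_plus (f g : R -> R -> C) :
  holomorphic f -> holomorphic g -> holomorphic (fun r t => f r t + g r t)%C.
Proof.
  intros [f' Hf] [g' Hg]; exists (fun r t => f' r t + g' r t)%C; intros r t Hr.
  destruct (Hf r t Hr) as (F1 & F2 & F3 & F4), (Hg r t Hr) as (G1 & G2 & G3 & G4).
  split; [ | split; [ | split]].
  - now apply is_cderive_plus.
  - rewrite Cmult_plus_distr_l.
    now apply (is_cderive_plus (fun r => f r t) (fun r => g r t)).
  - now apply cont2_plus.
  - now apply cont2_plus.
Qed.

Lemma holomorphic_mult (f g : R -> R -> C) :
  holomorphic f -> holomorphic g -> holomorphic (fun r t => f r t * g r t)%C.
Proof.
  intros [f' Hf] [g' Hg]; exists (fun r t => f' r t * g r t + f r t * g' r t)%C; intros r t Hr.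
  destruct (Hf r t Hr) as (F1 & F2 & F3 & F4), (Hg r t Hr) as (G1 & G2 & G3 & G4).
  split; [ | split; [ | split]].
  - now apply is_cderive_mult.
  - replace (Ci * _)%C with (Ci * f' r t * g r t + f r t * (Ci * g' r t))%C by ring.
    now apply (is_cderive_mult (fun r => f r t) (fun r => g r t)).
  - now apply cont2_mult.
  - apply cont2_plus; now apply cont2_mult.
Qed.

Lemma holomorphic_pow (f : R -> R -> C) (n : nat) :
  holomorphic f -> holomorphic (fun r t => f r t ^ n)%C.
Proof.
  intros Hf; induction n; simpl.
  - apply holomorphic_const.
  - now apply holomorphic_mult.
Qed.

Lemma holomorphic_inv (f : R -> R -> C) :
  (forall r t, 0 < r -> f r t <> 0) -> holomorphic f -> holomorphic (fun r t => / f r t)%C.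
Proof.
  intros N [f' Hf]; exists (fun r t => - f' r t * (/ f r t * / f r t))%C; intros r t Hr.
  destruct (Hf r t Hr) as (F1 & F2 & F3 & F4).
  assert (I := cont2_inv _ _ _ (N r t Hr) F3).
  split; [ | split; [ | split]].
  - apply is_cderive_inv; auto.
  - replace (Ci * _)%C with (- (Ci * f' r t) * (/ f r t * / f r t))%C by ring.
    apply (is_cderive_inv (fun r => f r t)); auto.
  - exact I.
  - apply cont2_mult; [ | now apply cont2_mult].
    destruct F4; split; now apply continuity_2d_pt_opp.
Qed.

Lemma holomorphic_cexp (f : R -> R -> C) :
  holomorphic f -> holomorphic (fun r t => cexp (f r t)).
Proof.
  intros [f' Hf]; exists (fun r t => f' r t * cexp (f r t))%C; intros r t Hr.
  destruct (Hf r t Hr) as (F1 & F2 & F3 & F4).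
  split; [ | split; [ | split]].
  - now apply is_cderive_cexp.
  - rewrite Cmult_assoc; now apply (is_cderive_cexp (fun r => f r t)).
  - now apply cont2_cexp.
  - apply cont2_mult; [assumption | now apply cont2_cexp].
Qed.

Lemma continuity_2d_pt_snd (f : R -> R -> R) (x y : R) :
  continuity_2d_pt f x y -> continuous (f x) y.
Proof.
  intros H; apply filterlim_locally; intros eps.
  destruct (H eps) as [d Hd]; exists d; intros v Hv.
  apply Hd; [rewrite Rminus_diag, Rabs_R0; apply cond_pos | exact Hv].
Qed.

(* Cauchy's theorem for the half strip: the vertical sides do not contribute. *)
Lemma contour_shift (f : R -> R -> C) :
  holomorphic f ->
  (forall r, 0 < r -> Re (f r 0) = 0 /\ Re (f r PI) = 0) ->
  forall r1 r2, 0 < r1 -> 0 < r2 ->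
  RInt (fun t => Im (f r1 t)) 0 PI = RInt (fun t => Im (f r2 t)) 0 PI.
Proof.
  intros [f' Hf] B.
  assert (Pi := PI_RGT_0).
  (* By the Cauchy-Riemann equations the [r]-derivative of [Im f] is [Re f'], which is the
     [t]-derivative of [Re f]. The derivative of the integral is thus a difference of boundary
     values, zero by [B]. *)
  assert (D : forall r, 0 < r -> is_derive (fun r => RInt (fun t => Im (f r t)) 0 PI) r 0).
  { intros r Hr.
    assert (Dr : forall s t, 0 < s -> is_derive (fun s => Im (f s t)) s (Re (f' s t))).
    { intros s t Hs; destruct (Hf s t Hs) as (_ & [_ H] & _).
      simpl in H; evar_last; [exact H | unfold Re; simpl; ring]. }
    assert (Nr : locally r (fun s => 0 < s)) by now apply open_gt.
    evar_last.
    - apply (is_derive_RInt_param (fun s t => Im (f s t)) 0 PI r).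
      + eapply filter_imp; [ | exact Nr]; intros s Hs t _.
        eexists; now apply Dr.
      + intros t _.
        apply (continuity_2d_pt_ext_loc (fun s t => Re (f' s t))).
        * exists (mkposreal r Hr); intros s v Hs _; simpl in Hs.
          symmetry; apply is_derive_unique, Dr.
          apply Rabs_def2 in Hs; lra.
        * now destruct (Hf r t Hr) as (_ & _ & _ & [H _]).
      + eapply filter_imp; [ | exact Nr]; intros s Hs.
        apply (@ex_RInt_continuous R_CompleteNormedModule); intros t _.
        destruct (Hf s t Hs) as (_ & _ & [_ H] & _).
        now apply continuity_2d_pt_snd in H.
    - apply is_RInt_unique.
      evar_last.
      + apply (is_RInt_ext (fun t => Re (f' r t))).
        * intros t _; symmetry; apply is_derive_unique; now apply Dr.
        * apply (is_RInt_derive (fun t => Re (f r t))).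
          -- intros t _; now destruct (Hf r t Hr) as ([H _] & _).
          -- intros t _; destruct (Hf r t Hr) as (_ & _ & _ & [H _]).
             now apply continuity_2d_pt_snd in H.
      + destruct (B r Hr) as [-> ->]; unfold minus, plus, opp; simpl; ring. }
  assert (M : forall r1 r2, 0 < r1 < r2 ->
    RInt (fun t => Im (f r1 t)) 0 PI = RInt (fun t => Im (f r2 t)) 0 PI).
  { intros r1 r2 [H1 H2].
    destruct (MVT_gen (fun r => RInt (fun t => Im (f r t)) 0 PI) r1 r2 (fun _ => 0))
      as (c & _ & E).
    - intros x Hx; apply D; rewrite Rmin_left in Hx; lra.
    - intros x Hx; rewrite Rmin_left in Hx by lra.
      apply continuity_pt_filterlim.
      apply (ex_derive_continuous (fun r => RInt (fun t => Im (f r t)) 0 PI)).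
      eexists; apply D; lra.
    - lra. }
  intros r1 r2 H1 H2; destruct (Rtotal_order r1 r2) as [H | [-> | H]].
  - now apply M.
  - reflexivity.
  - symmetry; now apply M.
Qed.

(** * The elliptic contours *)

Lemma cosh2_sinh2 (r : R) : cosh r ^ 2 = 1 + sinh r ^ 2.
Proof.
  unfold cosh, sinh; replace (exp (- r)) with (/ exp r) by (symmetry; apply exp_Ropp).
  field; apply Rgt_not_eq, exp_pos.
Qed.

Lemma cos2_sin2 (t : R) : cos t ^ 2 = 1 - sin t ^ 2.
Proof. generalize (sin2_cos2 t); unfold Rsqr; lra. Qed.

Lemma sinh_gt_0 (r : R) : 0 < r -> 0 < sinh r.
Proof.
  intros Hr; unfold sinh; assert (exp (- r) < exp r) by (apply exp_increasing; lra); lra.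
Qed.

Lemma cosh_ge_1 (r : R) : 1 <= cosh r.
Proof.
  assert (0 < cosh r) by (unfold cosh; generalize (exp_pos r), (exp_pos (- r)); lra).
  generalize (cosh2_sinh2 r), (pow2_ge_0 (sinh r)); nra.
Qed.

Lemma cosh_gt_1 (r : R) : 0 < r -> 1 < cosh r.
Proof.
  intros Hr; generalize (cosh2_sinh2 r), (cosh_ge_1 r), (sinh_gt_0 r Hr); nra.
Qed.

(* With [tau = t + i r]: [zc = (1 + cos tau) / 2], [uc] its derivative, and [Lc] the
   branch of [log (zc / (zc - 1))] that vanishes at infinity, and [Kc] is
   [z (z / (z - 1))^(z - 1)]. The curves [r = const] are confocal ellipses that
   degenerate to the segment [0, 1] when [r -> 0]. *)
Definition zc (r t : R) : C := ((1 + cosh r * cos t) / 2, - (sinh r * sin t) / 2).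
Definition uc (r t : R) : C := (- (cosh r * sin t) / 2, - (sinh r * cos t) / 2).
Definition Lc (r t : R) : C :=
  (ln (cosh r + cos t) - ln (cosh r - cos t), 2 * atan (sin t / sinh r)).
Definition Kc (r t : R) : C := ((zc r t - 1) * cexp (zc r t * Lc r t))%C.

Lemma Cmod_eq (z : C) (a : R) : 0 <= a -> Re z ^ 2 + Im z ^ 2 = a ^ 2 -> Cmod z = a.
Proof.
  intros Ha E; unfold Cmod; fold (Re z) (Im z); rewrite E.
  now apply sqrt_pow2.
Qed.

(** Together with [Cmod_zc_1] this gives the distances to the foci [0] and [1]; their sum [cosh r]
    is independent of [t], and their ratio explains the real part of [Lc]. *)
Lemma Cmod_zc (r t : R) : Cmod (zc r t) = (cosh r + cos t) / 2.
Proof.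
  generalize (cosh_ge_1 r), (COS_bound t); intros; apply Cmod_eq; [lra | ]; simpl.
  generalize (cosh2_sinh2 r), (cos2_sin2 t); nra.
Qed.

Lemma Cmod_zc_1 (r t : R) : Cmod (zc r t - 1) = (cosh r - cos t) / 2.
Proof.
  generalize (cosh_ge_1 r), (COS_bound t); intros; apply Cmod_eq; [lra | ]; simpl.
  generalize (cosh2_sinh2 r), (cos2_sin2 t); nra.
Qed.

(** The differential equation of [(1 + cos tau) / 2]: its derivative is [- sin tau / 2]. It controls
    [uc] through the two focal distances. *)
Lemma uc_sqr (r t : R) : (uc r t * uc r t = - (zc r t * (zc r t - 1)))%C.
Proof.
  generalize (cosh2_sinh2 r), (cos2_sin2 t); intros.
  apply injective_projections; simpl; nra.
Qed.

Lemma Cmod_uc (r t : R) : Cmod (uc r t) ^ 2 = Cmod (zc r t) * Cmod (zc r t - 1).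
Proof.
  rewrite <- Cmod_mult.
  replace (zc r t * (zc r t - 1))%C with (- (uc r t * uc r t))%C by (rewrite uc_sqr; ring).
  rewrite Cmod_opp, Cmod_mult; ring.
Qed.

Lemma zc_neq_0 (r t : R) : 0 < r -> zc r t <> 0.
Proof.
  intros Hr; apply Cmod_gt_0; rewrite Cmod_zc.
  generalize (cosh_gt_1 r Hr), (COS_bound t); lra.
Qed.

Lemma zc_neq_1 (r t : R) : 0 < r -> (zc r t - 1 <> 0)%C.
Proof.
  intros Hr; apply Cmod_gt_0; rewrite Cmod_zc_1.
  generalize (cosh_gt_1 r Hr), (COS_bound t); lra.
Qed.

Lemma cos_2atan (p : R) : cos (2 * atan p) = (1 - p ^ 2) / (1 + p ^ 2).
Proof.
  assert (0 < 1 + p ^ 2) by nra.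
  rewrite cos_2a_cos, cos_atan.
  assert (S : sqrt (1 + p²) ^ 2 = 1 + p ^ 2)
    by (rewrite pow2_sqrt; unfold Rsqr; nra).
  assert (0 < sqrt (1 + p²)) by (apply sqrt_lt_R0; unfold Rsqr; nra).
  replace (2 * _ * _ - 1) with (2 / sqrt (1 + p²) ^ 2 - 1) by (field; lra).
  rewrite S; field; lra.
Qed.

Lemma sin_2atan (p : R) : sin (2 * atan p) = 2 * p / (1 + p ^ 2).
Proof.
  assert (0 < 1 + p ^ 2) by nra.
  rewrite sin_2a, cos_atan, sin_atan.
  assert (S : sqrt (1 + p²) ^ 2 = 1 + p ^ 2)
    by (rewrite pow2_sqrt; unfold Rsqr; nra).
  assert (0 < sqrt (1 + p²)) by (apply sqrt_lt_R0; unfold Rsqr; nra).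
  rewrite <- S; field; lra.
Qed.

(** This certifies [Lc] as a logarithm of [z / (z - 1)]. The real part is the logarithm of the ratio
    of focal distances; the double-angle formulas for [atan] make the argument rational in
    [sin t / sinh r]. *)
Lemma cexp_Lc (r t : R) : 0 < r -> ((zc r t - 1) * cexp (Lc r t) = zc r t)%C.
Proof.
  intros Hr; assert (S := sinh_gt_0 r Hr); assert (Ch := cosh_gt_1 r Hr).
  assert (B := COS_bound t).
  assert (E1 := cosh2_sinh2 r); assert (E2 := cos2_sin2 t).
  assert (N : 0 < sinh r ^ 2 + sin t ^ 2) by nra.
  unfold cexp; simpl Re; simpl Im.
  replace (exp _) with ((cosh r + cos t) / (cosh r - cos t)).
  2: { unfold Rminus; rewrite exp_plus, exp_Ropp, !exp_ln by lra; field; lra. }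
  rewrite cos_2atan, sin_2atan.
  replace ((1 - (sin t / sinh r) ^ 2) / (1 + (sin t / sinh r) ^ 2))
    with ((sinh r ^ 2 - sin t ^ 2) / (sinh r ^ 2 + sin t ^ 2)) by (field; lra).
  replace (2 * (sin t / sinh r) / (1 + (sin t / sinh r) ^ 2))
    with (2 * (sin t * sinh r) / (sinh r ^ 2 + sin t ^ 2)) by (field; lra).
  (* Four times the product of the focal distances: the denominators now cancel and polynomial
     identities remain. *)
  assert (E : sinh r ^ 2 + sin t ^ 2 = (cosh r + cos t) * (cosh r - cos t)) by nra.
  rewrite E.
  replace (sinh r ^ 2 - sin t ^ 2) with (cosh r ^ 2 + cos t ^ 2 - 2) by lra.
  set (P := cosh r - cos t) in *.
  assert (P <> 0) by (unfold P; lra).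
  assert (cosh r + cos t <> 0) by lra.
  apply injective_projections; simpl.
  - apply (Rmult_eq_reg_r (P ^ 2)); [ | now apply pow_nonzero].
    transitivity (((1 + cosh r * cos t) / 2 - 1) * (cosh r ^ 2 + cos t ^ 2 - 2)
       + sinh r ^ 2 * sin t ^ 2); [field; auto | ].
    unfold P.
    replace (sin t ^ 2) with (1 - cos t ^ 2) by lra.
    replace (sinh r ^ 2) with (cosh r ^ 2 - 1) by lra. field.
  - apply (Rmult_eq_reg_r (P ^ 2)); [ | now apply pow_nonzero].
    transitivity (sin t * sinh r * (((1 + cosh r * cos t) / 2 - 1) * 2
       - (cosh r ^ 2 + cos t ^ 2 - 2) / 2)); [field; auto | ].
    unfold P; field.
Qed.

Lemma continuity_2d_pt_fst (f : R -> R) (x y : R) :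
  continuous f x -> continuity_2d_pt (fun u _ => f u) x y.
Proof.
  intros H; apply (continuity_2d_pt_comp1 f (fun u _ => u)); [exact H | ].
  apply continuity_2d_pt_id1.
Qed.

Lemma continuity_2d_pt_snd_only (f : R -> R) (x y : R) :
  continuous f y -> continuity_2d_pt (fun _ v => f v) x y.
Proof.
  intros H; apply (continuity_2d_pt_comp1 f (fun _ v => v)); [exact H | ].
  apply continuity_2d_pt_id2.
Qed.

Lemma ex_derive_continuous_R (f : R -> R) (x : R) : ex_derive f x -> continuous f x.
Proof. exact (ex_derive_continuous f x). Qed.

Ltac cont2d :=
  repeat first
    [ apply continuity_2d_pt_fst; apply ex_derive_continuous_R; auto_derive; solve [auto]
    | apply continuity_2d_pt_snd_only; apply ex_derive_continuous_R; auto_derive; solve [auto]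
    | apply continuity_2d_pt_plus | apply continuity_2d_pt_minus
    | apply continuity_2d_pt_opp | apply continuity_2d_pt_mult ].

Lemma cont2_zc (r t : R) : cont2 zc r t.
Proof. split; unfold zc, Rdiv; simpl; cont2d. Qed.

Lemma cont2_uc (r t : R) : cont2 uc r t.
Proof. split; unfold uc, Rdiv; simpl; cont2d. Qed.

Lemma is_cderive_zc (r t : R) :
  is_cderive (fun t => zc r t) t (uc r t) /\ is_cderive (fun r => zc r t) r (Ci * uc r t)%C.
Proof. split; split; simpl; auto_derive; auto; simpl; lra. Qed.

Lemma is_cderive_uc (r t : R) :
  is_cderive (fun t => uc r t) t (/ 2 - zc r t)%C /\
  is_cderive (fun r => uc r t) r (Ci * (/ 2 - zc r t))%C.
Proof. split; split; simpl; auto_derive; auto; simpl; lra. Qed.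

Lemma holomorphic_zc : holomorphic zc.
Proof.
  exists uc; intros r t _; destruct (is_cderive_zc r t).
  split; [ | split; [ | split]]; auto using cont2_zc, cont2_uc.
Qed.

Lemma holomorphic_uc : holomorphic uc.
Proof.
  exists (fun r t => / 2 + - 1 * zc r t)%C; intros r t _; destruct (is_cderive_uc r t).
  replace (/ 2 + - 1 * zc r t)%C with (/ 2 - zc r t)%C by ring.
  split; [ | split; [ | split]]; auto using cont2_uc.
  apply cont2_plus; [apply cont2_const | apply cont2_mult; [apply cont2_const | apply cont2_zc]].
Qed.

Lemma uc_neq_0 (r t : R) : 0 < r -> uc r t <> 0.
Proof.
  intros Hr E; generalize (uc_sqr r t); rewrite E, Cmult_0_l; intros F.
  apply (Cmult_neq_0 _ _ (zc_neq_0 r t Hr) (zc_neq_1 r t Hr)).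
  transitivity (- (- (zc r t * (zc r t - 1))))%C; [ring | ].
  rewrite <- F; apply Copp_0.
Qed.

(** The witness comes from the chain rule: [(1 / z - 1 / (z - 1)) u = - u / (z (z - 1))], which
    equals [1 / u] by [uc_sqr]. *)
Lemma holomorphic_Lc : holomorphic Lc.
Proof.
  exists (fun r t => / uc r t)%C; intros r t Hr.
  assert (S := sinh_gt_0 r Hr); assert (Ch := cosh_gt_1 r Hr); assert (B := COS_bound t).
  assert (E1 := cosh2_sinh2 r); assert (E2 := cos2_sin2 t).
  assert (N : 0 < sinh r ^ 2 + sin t ^ 2) by nra.
  assert (I : (/ uc r t)%C = (- 2 * (cosh r * sin t) / (sinh r ^ 2 + sin t ^ 2),
                              2 * (sinh r * cos t) / (sinh r ^ 2 + sin t ^ 2))).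
  { assert (D : (- (cosh r * sin t) / 2) * (- (cosh r * sin t) / 2) +
                (- (sinh r * cos t) / 2) * (- (sinh r * cos t) / 2)
                = (sinh r ^ 2 + sin t ^ 2) / 4) by nra.
    unfold Cinv, uc; simpl; rewrite !Rmult_1_r, D.
    apply injective_projections; simpl; field; lra. }
  assert (E : sinh r ^ 2 + sin t ^ 2 = (cosh r + cos t) * (cosh r - cos t)) by nra.
  assert (cosh r + cos t <> 0) by lra.
  assert (cosh r - cos t <> 0) by lra.
  split; [ | split; [ | split]].
  - rewrite I; split; unfold Lc, Re, Im, Cmult, Ci; cbn [fst snd].
    + auto_derive; [lra | ]. rewrite E; field; auto.
    + auto_derive; [lra | ]. field; split; [ | lra]; nra.
  - rewrite I; split; unfold Lc, Re, Im, Cmult, Ci; cbn [fst snd].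
    + auto_derive; [lra | ]. rewrite E; field; auto.
    + auto_derive; [lra | ]. field; split; [ | lra]; nra.
  - split; unfold Lc; simpl.
    + apply continuity_2d_pt_minus; apply (continuity_2d_pt_comp1 ln); try cont2d;
        apply continuous_ln; lra.
    + apply continuity_2d_pt_mult; [cont2d | ].
      apply (continuity_2d_pt_comp1 atan); [apply continuous_atan | ].
      apply continuity_2d_pt_mult; [cont2d | ].
      apply continuity_2d_pt_inv; [cont2d | lra].
  - apply cont2_inv; [now apply uc_neq_0 | apply cont2_uc].
Qed.

Lemma holomorphic_Kc : holomorphic Kc.
Proof.
  apply holomorphic_mult.
  - apply (holomorphic_plus zc (fun _ _ => (- RtoC 1)%C));
      [apply holomorphic_zc | apply holomorphic_const].
  - apply holomorphic_cexp, holomorphic_mult; [apply holomorphic_zc | apply holomorphic_Lc].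
Qed.

(* The form [(K + 1) z^(k - 1) dz]; since [K = -1] at [z = 0], the summand [1] removes the pole
   for [k = 0]. *)
Definition fc (k : nat) (r t : R) : C :=
  ((Kc r t + 1) * / zc r t * zc r t ^ k * uc r t)%C.

Lemma holomorphic_fc (k : nat) : holomorphic (fc k).
Proof.
  unfold fc; apply holomorphic_mult; [ | apply holomorphic_uc].
  apply holomorphic_mult; [ | apply holomorphic_pow, holomorphic_zc].
  apply holomorphic_mult.
  - apply holomorphic_plus; [apply holomorphic_Kc | apply holomorphic_const].
  - apply holomorphic_inv; [intros; now apply zc_neq_0 | apply holomorphic_zc].
Qed.

(** At [t = 0] and [t = PI] the point [z] lies on the real axis outside the slit: there [z] and the
    logarithm are real and [u] is purely imaginary. This is the boundary condition of
    [contour_shift]. *)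
Lemma fc_real (k : nat) (r t : R) : 0 < r -> sin t = 0 -> Re (fc k r t) = 0.
Proof.
  intros Hr S.
  assert (Z : zc r t = RtoC ((1 + cosh r * cos t) / 2))
    by (apply injective_projections; simpl; [ | rewrite S]; field).
  assert (L : Lc r t = RtoC (ln (cosh r + cos t) - ln (cosh r - cos t))).
  { apply injective_projections; simpl; [reflexivity | ].
    rewrite S; unfold Rdiv; rewrite Rmult_0_l, atan_0; ring. }
  assert (N := zc_neq_0 r t Hr); unfold fc, Kc; rewrite L, Z in *.
  assert (E : forall x : R, cexp (RtoC x) = RtoC (exp x)).
  { intros x; unfold cexp; simpl; rewrite sin_0, cos_0; apply injective_projections; simpl; ring. }
  rewrite <- RtoC_mult, E, <- RtoC_minus, <- RtoC_mult, <- RtoC_plus, <- RtoC_pow.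
  rewrite <- RtoC_inv by (contradict N; now rewrite N).
  rewrite <- !RtoC_mult, re_scal_l; simpl; rewrite S, Rmult_0_r, Ropp_0.
  unfold Rdiv; rewrite Rmult_0_l; apply Rmult_0_r.
Qed.

Lemma RInt_fc_const (k : nat) (r1 r2 : R) : 0 < r1 -> 0 < r2 ->
  RInt (fun t => Im (fc k r1 t)) 0 PI = RInt (fun t => Im (fc k r2 t)) 0 PI.
Proof.
  apply contour_shift; [apply holomorphic_fc | ].
  intros r Hr; split; apply fc_real; auto using sin_0, sin_PI.
Qed.

(** * The generating series of [b] *)

Lemma length_blist (k : nat) : length (blist k) = k.
Proof. induction k; simpl; [reflexivity | rewrite length_app, IHk; simpl; lia]. Qed.

Lemma nth_blist (k i : nat) : (i < k)%nat -> nth i (blist k) 0 = b (S i).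
Proof.
  intros H; induction k as [ | k IH]; [lia | ].
  destruct (Nat.eq_dec i k) as [-> | N].
  - unfold b; now replace (S k - 1)%nat with k by lia.
  - simpl; rewrite app_nth1 by (rewrite length_blist; lia); apply IH; lia.
Qed.

Lemma b_1 : b 1 = / 2.
Proof. reflexivity. Qed.

Lemma b_rec (n : nat) :
  (INR n + 2) * b (S (S n)) = / (INR n + 3) - sum_f_R0 (fun i => b (S i) / INR (n + 2 - i)) n.
Proof.
  assert (E : b (S (S n)) = b_next (S n) (blist (S n))).
  { unfold b; replace (S (S n) - 1)%nat with (S n) by lia.
    change (blist (S (S n))) with (blist (S n) ++ b_next (S n) (blist (S n)) :: nil).
    rewrite app_nth2; rewrite length_blist; [ | lia].
    now rewrite Nat.sub_diag. }
  rewrite E; unfold b_next.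
  rewrite (sum_eq _ (fun i => b (S i) / INR (n + 2 - i))).
  - field; generalize (pos_INR n); lra.
  - intros i Hi; now rewrite nth_blist by lia.
Qed.

(* Coefficients of [(1 + 1/x)^x / e] in powers of [1 / (1 + x)]. *)
Definition acoef (n : nat) : R := match n with O => 1 | _ => - b n end.

(** With [v = 1 / (1 + x)], these are the Taylor coefficients of minus the logarithmic derivative in
    [v] of [(1 + 1/x)^x]. *)
Definition mcoef (n : nat) : R := / INR (n + 2).

(** The defining recurrence of [b], read as the coefficient form of the differential equation
    [A' = - A M], with [A] and [M] the series of [acoef] and [mcoef]. *)
Lemma acoef_rec (n : nat) : INR (S n) * acoef (S n) = - PS_mult acoef mcoef n.
Proof.
  unfold PS_mult; destruct n as [ | n].
  - unfold acoef, mcoef; rewrite b_1; simpl; field.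
  - rewrite decomp_sum by lia.
    replace (pred (S n)) with n by reflexivity.
    change (acoef (S (S n))) with (- b (S (S n))).
    replace (INR (S (S n))) with (INR n + 2) by (rewrite !S_INR; ring).
    rewrite Ropp_mult_distr_r_reverse, b_rec.
    rewrite (sum_eq (fun i => acoef (S i) * mcoef (S n - S i))
               (fun i => (b (S i) / INR (n + 2 - i)) * - (1))).
    + rewrite <- scal_sum; unfold acoef at 1, mcoef at 1; rewrite Nat.sub_0_r.
      replace (INR (S n + 2)) with (INR n + 3)
        by (rewrite plus_INR, S_INR; simpl; ring).
      ring.
    + intros i Hi; unfold mcoef; simpl.
      replace (n - i + 2)%nat with (n + 2 - i)%nat by lia.
      unfold Rdiv; ring.
Qed.

Lemma Rabs_sum_le (u : nat -> R) (c : R) (n : nat) :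
  (forall k, (k <= n)%nat -> Rabs (u k) <= c) -> Rabs (sum_f_R0 u n) <= INR (S n) * c.
Proof.
  intros H.
  eapply Rle_trans; [apply Rsum_abs | ].
  eapply Rle_trans; [apply (sum_Rle _ (fun _ => c)); intros; now apply H | ].
  rewrite sum_cte; lra.
Qed.

(** The convolution in [acoef_rec] has as many terms as the factor [INR (S n)] on the left, each at
    most [1] in modulus by strong induction. *)
Lemma acoef_bound (n : nat) : Rabs (acoef n) <= 1.
Proof.
  induction n as [n IH] using lt_wf_ind.
  destruct n as [ | n]; [simpl; rewrite Rabs_R1; lra | ].
  assert (P : 0 < INR (S n)) by (apply lt_0_INR; lia).
  apply (Rmult_le_reg_l (INR (S n))); [exact P | ].
  rewrite <- (Rabs_right (INR (S n))) at 1 by lra.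
  rewrite <- Rabs_mult, acoef_rec, Rabs_Ropp.
  apply Rabs_sum_le; intros k Hk; rewrite Rabs_mult.
  rewrite <- (Rmult_1_l 1); apply Rmult_le_compat; try apply Rabs_pos.
  - apply IH; lia.
  - unfold mcoef; rewrite Rabs_inv, Rabs_right by (apply Rle_ge, pos_INR).
    rewrite <- Rinv_1; apply Rinv_le_contravar; [lra | ].
    apply (le_INR 1); lia.
Qed.

(* [cps a v t] is the sum of the power series with coefficients [a] at [t v]. *)
Definition cps (a : nat -> R) (v : C) (t : R) : C :=
  (PSeries (fun n => a n * Re (v ^ n)%C) t, PSeries (fun n => a n * Im (v ^ n)%C) t).

(** Growth [2 ^ n] admits the derivatives of series with bounded coefficients. Against
    [Cmod v <= / 4] it leaves a radius of convergence of at least [2] in [t], hence termwise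
    calculus for [Rabs t <= 1]. *)
Definition geom_bound (a : nat -> R) : Prop := forall n, Rabs (a n) <= 2 ^ n.

Lemma pow_2_ge_1 (n : nat) : 1 <= 2 ^ n.
Proof. apply pow_R1_Rle; lra. Qed.

Lemma bounded_geom (a : nat -> R) : (forall n, Rabs (a n) <= 1) -> geom_bound a.
Proof. intros H n; eapply Rle_trans; [apply H | apply pow_2_ge_1]. Qed.

Lemma geom_mcoef : geom_bound mcoef.
Proof.
  apply bounded_geom; intros n; unfold mcoef.
  rewrite Rabs_inv, Rabs_right by (apply Rle_ge, pos_INR).
  rewrite <- Rinv_1; apply Rinv_le_contravar; [lra | apply (le_INR 1); lia].
Qed.

Lemma INR_le_pow2 (n : nat) : INR (S n) <= 2 ^ n.
Proof.
  induction n; [simpl; lra | ].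
  rewrite S_INR; simpl pow; generalize (pow_2_ge_1 n); lra.
Qed.

Lemma geom_derive (a : nat -> R) : (forall n, Rabs (a n) <= 1) -> geom_bound (PS_derive a).
Proof.
  intros H n; unfold PS_derive; rewrite Rabs_mult, Rabs_right by (apply Rle_ge, pos_INR).
  rewrite <- (Rmult_1_r (2 ^ n)); apply Rmult_le_compat; auto using Rabs_pos, pos_INR, INR_le_pow2.
Qed.

Lemma Rabs_Re_le (z : C) : Rabs (Re z) <= Cmod z.
Proof. eapply Rle_trans; [apply Rmax_l | apply Rmax_Cmod]. Qed.

Lemma Rabs_Im_le (z : C) : Rabs (Im z) <= Cmod z.
Proof. eapply Rle_trans; [apply Rmax_r | apply Rmax_Cmod]. Qed.

Lemma Cmod_le_ReIm (z : C) : Cmod z <= Rabs (Re z) + Rabs (Im z).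
Proof.
  replace z with (RtoC (Re z) + Ci * RtoC (Im z))%C at 1
    by (apply injective_projections; simpl; unfold Re, Im; ring).
  eapply Rle_trans; [apply Cmod_triangle | ].
  rewrite Cmod_mult, !Cmod_R; replace (Cmod Ci) with 1; [lra | ].
  unfold Cmod, Ci; simpl; replace (_ + _) with 1 by ring; now rewrite sqrt_1.
Qed.

Lemma Cmod_pow_quarter (v : C) (Hv : Cmod v <= / 4) (n : nat) : Cmod (v ^ n) * 4 ^ n <= 1.
Proof.
  rewrite Cmod_pow, <- Rpow_mult_distr, <- (pow1 n).
  apply pow_incr; generalize (Cmod_ge_0 v); lra.
Qed.

Lemma cps_radius (v : C) (Hv : Cmod v <= / 4) (a : nat -> R) (p : C -> R) (t : R) :
  geom_bound a -> (forall z, Rabs (p z) <= Cmod z) -> Rabs t <= 1 ->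
  Rbar_lt (Rabs t) (CV_radius (fun n => a n * p (v ^ n)%C)).
Proof.
  intros Ha Hp Ht; apply (Rbar_lt_le_trans _ 2); [simpl; lra | ].
  apply CV_radius_bounded; exists 1; intros n.
  rewrite !Rabs_mult, (Rabs_right (2 ^ n)) by (apply Rle_ge, pow_le; lra).
  eapply Rle_trans; [ | apply (Cmod_pow_quarter v Hv n)].
  replace (4 ^ n) with (2 ^ n * 2 ^ n) by (rewrite <- Rpow_mult_distr; f_equal; ring).
  assert (P := pow_2_ge_1 n).
  replace (Cmod (v ^ n) * (2 ^ n * 2 ^ n)) with (2 ^ n * Cmod (v ^ n) * 2 ^ n) by ring.
  apply Rmult_le_compat_r; [lra | ].
  apply Rmult_le_compat; auto using Rabs_pos.
Qed.

Lemma cps_ext (v : C) (a a' : nat -> R) (t : R) : (forall n, a n = a' n) -> cps a v t = cps a' v t.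
Proof.
  intros E; unfold cps; f_equal; apply PSeries_ext; intros n; now rewrite E.
Qed.

Lemma ex_cps (v : C) (Hv : Cmod v <= / 4) (a : nat -> R) (p : C -> R) (t : R) :
  geom_bound a -> (forall z, Rabs (p z) <= Cmod z) -> Rabs t <= 1 ->
  ex_pseries (fun n => a n * p (v ^ n)%C) t.
Proof. intros; now apply CV_radius_inside, cps_radius. Qed.

#[local] Hint Resolve Rabs_Re_le Rabs_Im_le cps_radius ex_cps : cps.

Lemma cps_plus (v : C) (Hv : Cmod v <= / 4) (a a' : nat -> R) (t : R) :
  geom_bound a -> geom_bound a' -> Rabs t <= 1 ->
  cps (fun n => a n + a' n) v t = (cps a v t + cps a' v t)%C.
Proof.
  intros H H' Ht; apply injective_projections; simpl.
  - rewrite <- PSeries_plus by auto with cps.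
    apply PSeries_ext; intros n; unfold PS_plus, plus; simpl; ring.
  - rewrite <- PSeries_plus by auto with cps.
    apply PSeries_ext; intros n; unfold PS_plus, plus; simpl; ring.
Qed.

Lemma cps_opp (v : C) (a : nat -> R) (t : R) : cps (fun n => - a n) v t = (- cps a v t)%C.
Proof.
  apply injective_projections; simpl; rewrite <- PSeries_opp;
    apply PSeries_ext; intros n; unfold PS_opp, opp; simpl; ring.
Qed.

Lemma PSeries_lin (a a' : nat -> R) (c c' t : R) :
  ex_pseries a t -> ex_pseries a' t ->
  PSeries (fun n => c * a n + c' * a' n) t = c * PSeries a t + c' * PSeries a' t.
Proof.
  intros H H'.
  rewrite <- (PSeries_scal c a t), <- (PSeries_scal c' a' t).
  rewrite <- PSeries_plus; [reflexivity | | ];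
    apply ex_pseries_scal; auto; intros; apply Rmult_comm.
Qed.

Lemma cps_decr (v : C) (Hv : Cmod v <= / 4) (a : nat -> R) (t : R) :
  geom_bound (fun n => a (S n)) -> geom_bound a -> Rabs t <= 1 ->
  cps a v t = (RtoC (a 0%nat) + RtoC t * v * cps (fun n => a (S n)) v t)%C.
Proof.
  intros H H0 Ht; apply injective_projections; simpl.
  - rewrite PSeries_decr_1 by auto with cps.
    rewrite (PSeries_ext _ (fun n => Re v * (a (S n) * Re (v ^ n)%C) +
                                     (- Im v) * (a (S n) * Im (v ^ n)%C))).
    + rewrite PSeries_lin by auto with cps; unfold Re, Im; simpl; ring.
    + intros n; unfold PS_decr_1; simpl; unfold Re, Im; ring.
  - rewrite PSeries_decr_1 by auto with cps.
    rewrite (PSeries_ext _ (fun n => Re v * (a (S n) * Im (v ^ n)%C) +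
                                     Im v * (a (S n) * Re (v ^ n)%C))).
    + rewrite PSeries_lin by auto with cps; unfold Re, Im; simpl; ring.
    + intros n; unfold PS_decr_1; simpl; unfold Re, Im; ring.
Qed.

Lemma cps_derive (v : C) (Hv : Cmod v <= / 4) (a : nat -> R) (t : R) :
  geom_bound (PS_derive a) -> geom_bound a -> Rabs t <= 1 ->
  is_cderive (cps a v) t (v * cps (PS_derive a) v t)%C.
Proof.
  intros H H0 Ht; split; simpl.
  - evar_last; [apply is_derive_PSeries; auto with cps | ].
    rewrite (PSeries_ext _ (fun n => Re v * (PS_derive a n * Re (v ^ n)%C) +
                                     (- Im v) * (PS_derive a n * Im (v ^ n)%C))).
    + rewrite PSeries_lin by auto with cps; unfold Re, Im; simpl; ring.
    + intros n; unfold PS_derive; simpl; unfold Re, Im; ring.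
  - evar_last; [apply is_derive_PSeries; auto with cps | ].
    rewrite (PSeries_ext _ (fun n => Re v * (PS_derive a n * Im (v ^ n)%C) +
                                     Im v * (PS_derive a n * Re (v ^ n)%C))).
    + rewrite PSeries_lin by auto with cps; unfold Re, Im; simpl; ring.
    + intros n; unfold PS_derive; simpl; unfold Re, Im; ring.
Qed.

Lemma cps_mult (v : C) (Hv : Cmod v <= / 4) (a a' : nat -> R) (t : R) :
  geom_bound a -> geom_bound a' -> Rabs t <= 1 ->
  cps (PS_mult a a') v t = (cps a v t * cps a' v t)%C.
Proof.
  intros H H' Ht.
  assert (M : forall p q, (forall z, Rabs (p z) <= Cmod z) -> (forall z, Rabs (q z) <= Cmod z) ->
    ex_pseries (PS_mult (fun n => a n * p (v ^ n)%C) (fun n => a' n * q (v ^ n)%C)) t).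
  { intros; apply ex_pseries_mult; auto with cps. }
  apply injective_projections; simpl.
  - rewrite <- !PSeries_mult by auto with cps.
    match goal with |- _ = ?x - ?y => transitivity (1 * x + (-1) * y); [ | ring] end.
    rewrite <- PSeries_lin by auto with cps.
    apply PSeries_ext; intros n; unfold PS_mult.
    rewrite (Rmult_comm _ (Re _)), !scal_sum, <- sum_plus.
    apply sum_eq; intros i Hi.
    replace (v ^ n)%C with (v ^ i * v ^ (n - i))%C by (rewrite <- Cpow_add_r; f_equal; lia).
    simpl; unfold Re, Im; ring.
  - rewrite <- !PSeries_mult by auto with cps.
    match goal with |- _ = ?x + ?y => transitivity (1 * x + 1 * y); [ | ring] end.
    rewrite <- PSeries_lin by auto with cps.
    apply PSeries_ext; intros n; unfold PS_mult.
    rewrite (Rmult_comm _ (Im _)), !scal_sum, <- sum_plus.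
    apply sum_eq; intros i Hi.
    replace (v ^ n)%C with (v ^ i * v ^ (n - i))%C by (rewrite <- Cpow_add_r; f_equal; lia).
    simpl; unfold Re, Im; ring.
Qed.

(** Each of the two components is dominated by the geometric series of ratio [1 / 4], with sum
    [4 / 3]. *)
Lemma Cmod_cps_le (v : C) (Hv : Cmod v <= / 4) (a : nat -> R) : (forall n, Rabs (a n) <= 1) -> Cmod (cps a v 1) <= 8 / 3.
Proof.
  intros Ha.
  assert (G : is_series (fun n => (/ 4) ^ n) (/ (1 - / 4)))
    by (apply is_series_geom; rewrite Rabs_right; lra).
  assert (B : forall p, (forall z, Rabs (p z) <= Cmod z) ->
    Rabs (PSeries (fun n => a n * p (v ^ n)%C) 1) <= 4 / 3).
  { intros p Hp.
    assert (T : forall n, Rabs (a n * p (v ^ n)%C * 1 ^ n) <= (/ 4) ^ n).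
    { intros n; rewrite pow1, Rmult_1_r, Rabs_mult, <- (Rmult_1_l (_ ^ n)).
      apply Rmult_le_compat; auto using Rabs_pos.
      eapply Rle_trans; [apply Hp | ]; rewrite Cmod_pow.
      apply pow_incr; split; [apply Cmod_ge_0 | exact Hv]. }
    unfold PSeries; eapply Rle_trans.
    - apply Series_Rabs, (@ex_series_le R_AbsRing R_CompleteNormedModule _ (fun n => (/ 4) ^ n)); [ | exists (/ (1 - / 4)); exact G].
      intros n; unfold norm; simpl; unfold abs; simpl; rewrite Rabs_Rabsolu; apply T.
    - replace (4 / 3) with (/ (1 - / 4)) by field.
      rewrite <- (is_series_unique _ _ G); apply Series_le; [ | exists (/ (1 - / 4)); exact G].
      intros n; split; [apply Rabs_pos | apply T]. }
  eapply Rle_trans; [apply Cmod_le_ReIm | ].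
  generalize (B Re Rabs_Re_le), (B Im Rabs_Im_le); simpl; lra.
Qed.

Lemma is_derive_0_const (f : R -> R) :
  (forall t, 0 <= t <= 1 -> is_derive f t 0) -> f 1 = f 0.
Proof.
  intros H; destruct (MVT_gen f 0 1 (fun _ => 0)) as (c & _ & E).
  - intros x Hx; rewrite Rmin_left, Rmax_right in Hx by lra; apply H; lra.
  - intros x Hx; rewrite Rmin_left, Rmax_right in Hx by lra.
    apply continuity_pt_filterlim, ex_derive_continuous_R; eexists; apply H; lra.
  - lra.
Qed.

Lemma is_cderive_0_const (f : R -> C) :
  (forall t, 0 <= t <= 1 -> is_cderive f t 0) -> f 1 = f 0.
Proof.
  intros H; apply injective_projections.
  - apply (is_derive_0_const (fun t => Re (f t))); intros t Ht; apply (H t Ht).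
  - apply (is_derive_0_const (fun t => Im (f t))); intros t Ht; apply (H t Ht).
Qed.

(** In [v = 1 / (1 + x)], the coefficients [qcoef], [lcoef], [ecoef] are those of
    [- log (1 - v) / v], of [- log (1 - v)], and of the exponent [x log (1 + 1/x) = (1 - v) (- log
    (1 - v) / v)]. *)
Definition qcoef (n : nat) : R := / INR (S n).
Definition lcoef (n : nat) : R := match n with O => 0 | S m => / INR (S m) end.
Definition ecoef (n : nat) : R :=
  match n with O => 1 | S m => - / (INR (S m) * INR (S (S m))) end.

Lemma inv_INR_bound (n : nat) : Rabs (/ INR (S n)) <= 1.
Proof.
  rewrite Rabs_inv, Rabs_right by (apply Rle_ge, pos_INR).
  rewrite <- Rinv_1; apply Rinv_le_contravar; [lra | apply (le_INR 1); lia].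
Qed.

Lemma lcoef_bound (n : nat) : Rabs (lcoef n) <= 1.
Proof. destruct n; [simpl; rewrite Rabs_R0; lra | apply inv_INR_bound]. Qed.

Lemma ecoef_bound (n : nat) : Rabs (ecoef n) <= 1.
Proof.
  destruct n; [simpl; rewrite Rabs_R1; lra | ].
  unfold ecoef; rewrite Rabs_Ropp, Rinv_mult, Rabs_mult, <- (Rmult_1_l 1).
  apply Rmult_le_compat; auto using Rabs_pos, inv_INR_bound.
Qed.

Lemma cps_at_0 (a : nat -> R) (v : C) : cps a v 0 = RtoC (a 0%nat).
Proof.
  apply injective_projections; simpl; rewrite PSeries_0; simpl; ring.
Qed.

Lemma is_cderive_line (v : C) (t : R) : is_cderive (fun t => 1 - RtoC t * v)%C t (- v)%C.
Proof. split; simpl; auto_derive; auto; unfold Re, Im; simpl; ring. Qed.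

(** Both exponential identities are proved along the ray [t v], [0 <= t <= 1]: the products
    [exp(l) (1 - t v)] and [A exp(- E)] have zero derivative, and their values at [t = 0] are [1]
    and [exp(-1)]. This needs no complex logarithm. *)
Lemma acoef_series (v : C) : Cmod v <= / 4 ->
  exists q : C, Cmod q <= 8 / 3 /\ (cexp (v * q) * (1 - v) = 1)%C /\
    (RtoC (exp 1) * cps acoef v 1 = cexp ((1 - v) * q))%C.
Proof.
  intros Hv; exists (cps qcoef v 1).
  assert (B1 : Rabs 1 <= 1) by (rewrite Rabs_R1; lra).
  assert (B : forall t, 0 <= t <= 1 -> Rabs t <= 1) by (intros; rewrite Rabs_right; lra).
  assert (Gq : geom_bound qcoef) by apply bounded_geom, inv_INR_bound.
  assert (Gl : geom_bound lcoef) by apply bounded_geom, lcoef_bound.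
  assert (Ge : geom_bound ecoef) by apply bounded_geom, ecoef_bound.
  assert (Ga : geom_bound acoef) by apply bounded_geom, acoef_bound.
  assert (Go : geom_bound (fun _ => 1))
    by (apply bounded_geom; intros; rewrite Rabs_R1; lra).
  assert (L : cps lcoef v 1 = (v * cps qcoef v 1)%C).
  { rewrite cps_decr by auto.
    change (fun n => lcoef (S n)) with qcoef; change (lcoef 0) with 0; ring. }
  split; [apply Cmod_cps_le; auto; intros; apply inv_INR_bound | split].
  - rewrite <- L.
    assert (E : (cexp (cps lcoef v 1) * (1 - RtoC 1 * v) =
                 cexp (cps lcoef v 0) * (1 - RtoC 0 * v))%C).
    { apply (is_cderive_0_const (fun t => cexp (cps lcoef v t) * (1 - RtoC t * v))%C).
      intros t Ht.
      assert (D : is_cderive (cps lcoef v) t (v * cps (fun _ => 1) v t)%C).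
      { rewrite (cps_ext v (fun _ => 1) (PS_derive lcoef) t).
        - apply cps_derive; auto using geom_derive, lcoef_bound.
        - intros n; unfold PS_derive, lcoef; field; apply not_0_INR; lia. }
      assert (O : (cps (fun _ => 1) v t * (1 - RtoC t * v) = 1)%C).
      { transitivity (cps (fun _ => 1) v t - RtoC t * v * cps (fun _ => 1) v t)%C; [ring | ].
        rewrite (cps_decr v Hv (fun _ => 1)) at 1 by auto; ring. }
      replace (RtoC 0) with (v * cps (fun _ => 1) v t * cexp (cps lcoef v t) * (1 - RtoC t * v)
                             + cexp (cps lcoef v t) * - v)%C.
      - apply is_cderive_mult; [now apply is_cderive_cexp | apply is_cderive_line].
      - transitivity (v * cexp (cps lcoef v t) *
                       (cps (fun _ => 1) v t * (1 - RtoC t * v) - 1))%C; [ring | ].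
        rewrite O; ring. }
    rewrite cps_at_0 in E; simpl lcoef in E; rewrite cexp_0 in E.
    transitivity (cexp (cps lcoef v 1) * (1 - RtoC 1 * v))%C; [ring | rewrite E; ring].
  - assert (E : cps ecoef v 1 = ((1 - v) * cps qcoef v 1)%C).
    { set (q := cps qcoef v 1).
      assert (Gd : geom_bound (fun n => ecoef (S n)))
        by (apply bounded_geom; intros; apply ecoef_bound).
      (* Coefficientwise this is [1 / (n + 2) = 1 / (n + 1) - 1 / ((n + 1) (n + 2))]. *)
      assert (Eq : (q = 1 + v * (cps (fun n => ecoef (S n)) v 1 + q))%C).
      { unfold q at 1; rewrite cps_decr; auto.
        - replace (qcoef 0) with 1 by (unfold qcoef; simpl; field).
          rewrite (cps_ext v _ (fun n => ecoef (S n) + qcoef n)).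
          + rewrite cps_plus by auto; fold q; ring.
          + intros n; unfold ecoef, qcoef; rewrite !S_INR; generalize (pos_INR n); intros; field; lra.
        - apply bounded_geom; intros; apply inv_INR_bound. }
      rewrite cps_decr by auto; fold q; simpl (ecoef 0).
      transitivity ((1 + v * (cps (fun n => ecoef (S n)) v 1 + q)) - v * q)%C; [ring | ].
      rewrite <- Eq; ring. }
    rewrite <- E.
    assert (F : (cps acoef v 1 * cexp (- cps ecoef v 1) = cps acoef v 0 * cexp (- cps ecoef v 0))%C).
    { apply (is_cderive_0_const (fun t => cps acoef v t * cexp (- cps ecoef v t))%C).
      intros t Ht.
      assert (Da : is_cderive (cps acoef v) t (v * - (cps acoef v t * cps mcoef v t))%C).
      { rewrite <- cps_mult, <- cps_opp by auto using geom_mcoef.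
        rewrite (cps_ext v _ (PS_derive acoef)).
        - apply cps_derive; auto using geom_derive, acoef_bound.
        - intros n; unfold PS_derive; now rewrite acoef_rec. }
      assert (De : is_cderive (fun t => - cps ecoef v t)%C t (v * cps mcoef v t)%C).
      { assert (D : is_cderive (cps ecoef v) t (v * - cps mcoef v t)%C).
        { rewrite <- cps_opp, (cps_ext v _ (PS_derive ecoef)).
          - apply cps_derive; auto using geom_derive, ecoef_bound.
          - intros n; unfold PS_derive, ecoef, mcoef.
            replace (n + 2)%nat with (S (S n)) by lia.
            field; split; apply not_0_INR; lia. }
        replace (v * cps mcoef v t)%C
          with (0 * cps ecoef v t + - (1) * (v * - cps mcoef v t))%C by ring.
        apply (is_cderive_ext (fun t => - (1) * cps ecoef v t)%C); [intros; ring | ].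
        apply (is_cderive_mult (fun _ => - (1))%C); [apply is_cderive_const | exact D]. }
      replace (RtoC 0) with (v * - (cps acoef v t * cps mcoef v t) * cexp (- cps ecoef v t)
        + cps acoef v t * (v * cps mcoef v t * cexp (- cps ecoef v t)))%C by ring.
      apply is_cderive_mult; [exact Da | ].
      now apply (is_cderive_cexp (fun t => - cps ecoef v t)%C). }
    rewrite !cps_at_0 in F; simpl acoef in F; simpl ecoef in F.
    transitivity (RtoC (exp 1) * (cps acoef v 1 * cexp (- cps ecoef v 1)) * cexp (cps ecoef v 1))%C.
    + transitivity (RtoC (exp 1) * cps acoef v 1 *
        (cexp (cps ecoef v 1) * cexp (- cps ecoef v 1)))%C; [rewrite cexp_opp_r; ring | ring].
    + rewrite F.
      replace (RtoC (exp 1)) with (cexp 1).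
      * transitivity (cexp 1 * cexp (- RtoC 1) * cexp (cps ecoef v 1))%C; [ring | ].
        rewrite cexp_opp_r; ring.
      * unfold cexp; simpl; rewrite cos_0, sin_0; apply injective_projections; simpl; ring.
Qed.

(** The tail is [v ^ S N] times a series whose coefficients are again bounded by [1], so the same
    bound [8 / 3] holds for every [N]. *)
Lemma acoef_remainder (v : C) (N : nat) : Cmod v <= / 4 ->
  exists s : C, Cmod s <= 8 / 3 /\
    (cps acoef v 1 = sum_n (fun n => RtoC (acoef n) * v ^ n) N + v ^ S N * s)%C.
Proof.
  intros Hv.
  exists (cps (fun n => acoef (n + S N)) v 1); split.
  { apply Cmod_cps_le; auto; intros; apply acoef_bound. }
  assert (B1 : Rabs 1 <= 1) by (rewrite Rabs_R1; lra).
  assert (G : forall k, geom_bound (fun n => acoef (n + k)))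
    by (intros; apply bounded_geom; intros; apply acoef_bound).
  assert (D : forall k, cps (fun n => acoef (n + k)) v 1 =
    (RtoC (acoef k) + v * cps (fun n => acoef (n + S k)) v 1)%C).
  { intros k; rewrite cps_decr; auto.
    - rewrite (cps_ext v (fun n => acoef (S n + k)) (fun n => acoef (n + S k)));
        [rewrite Nat.add_0_l; ring | intros n; f_equal; lia].
    - apply bounded_geom; intros; apply acoef_bound. }
  rewrite (cps_ext v acoef (fun n => acoef (n + 0))) by (intros; f_equal; lia).
  induction N.
  - rewrite sum_O, D; simpl; ring.
  - rewrite IHN, sum_Sn, D; unfold plus; simpl; ring.
Qed.

(** * The contour at infinity *)

(** Serves to identify two branches of a logarithm. Half the difference of the imaginary parts has
    vanishing sine and lies strictly between [- PI] and [PI]. *)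
Lemma cexp_inj (x y : C) : cexp x = cexp y -> Rabs (Im x - Im y) < 2 * PI -> x = y.
Proof.
  intros E H; assert (Pi := PI_RGT_0).
  assert (R1 : Re x = Re y) by (apply exp_inv; rewrite <- !Cmod_cexp; now rewrite E).
  apply injective_projections; [exact R1 | ].
  unfold cexp in E; rewrite R1 in E; injection E; intros E2 E1.
  assert (P := exp_pos (Re y)).
  apply Rmult_eq_reg_l in E1, E2; try lra.
  assert (C1 : cos (Im x - Im y) = 1).
  { rewrite cos_minus, E1, E2; generalize (sin2_cos2 (Im y)); unfold Rsqr; lra. }
  assert (S : sin ((Im x - Im y) / 2) = 0).
  { replace (Im x - Im y) with (2 * ((Im x - Im y) / 2)) in C1 by field.
    rewrite cos_2a_sin in C1; nra. }
  apply Rabs_def2 in H.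
  destruct (Rtotal_order (Im x - Im y) 0) as [N | [N | N]]; [ | change (Im x = Im y); lra | ].
  - assert (0 < sin (- ((Im x - Im y) / 2))) by (apply sin_gt_0; lra).
    rewrite sin_neg in *; lra.
  - assert (0 < sin ((Im x - Im y) / 2)) by (apply sin_gt_0; lra); lra.
Qed.

(** Near infinity [Lc] must be the power series branch [q / z]: both exponentiate to [z / (z - 1)],
    and their imaginary parts are at most [PI] and [2 / 3], so they differ by less than [2 PI]. Then
    [Kc = z exp ((z - 1) L)] is the generating series of [acoef]. *)
Lemma Kc_series (r t : R) : 0 < r -> 1 <= sinh r -> 4 <= Cmod (zc r t) ->
  (Kc r t = RtoC (exp 1) * zc r t * cps acoef (/ zc r t) 1)%C.
Proof.
  intros Hr Hs Hz.
  assert (N := zc_neq_0 r t Hr).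
  set (z := zc r t) in *.
  assert (Hv : Cmod (/ z) <= / 4) by (rewrite Cmod_inv by auto; apply Rinv_le_contravar; lra).
  destruct (acoef_series (/ z)%C Hv) as (q & Hq & E1 & E2).
  assert (E3 := cexp_Lc r t Hr); fold z in E3.
  assert (L : (/ z * q = Lc r t)%C).
  { apply cexp_inj.
    - transitivity (cexp (/ z * q) * (1 - / z) * cexp (Lc r t))%C.
      + transitivity (cexp (/ z * q) * ((z - 1) * cexp (Lc r t) * / z))%C;
          [rewrite E3; field; auto | field; auto].
      + rewrite E1; ring.
    - assert (B1 : Rabs (Im (/ z * q)%C) <= / 4 * (8 / 3)).
      { eapply Rle_trans; [apply Rabs_Im_le | ]; rewrite Cmod_mult.
        apply Rmult_le_compat; auto using Cmod_ge_0. }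
      assert (B2 : Rabs (Im (Lc r t)) <= PI).
      { simpl; generalize (atan_bound (sin t / sinh r)); intros; apply Rabs_le; lra. }
      assert (Pi := PI2_3_2).
      eapply Rle_lt_trans; [apply Rabs_triang | rewrite Rabs_Ropp; lra]. }
  transitivity (z * (RtoC (exp 1) * cps acoef (/ z) 1))%C; [ | ring].
  rewrite E2.
  replace ((1 - / z) * q)%C with ((z - 1) * (/ z * q))%C by (field; auto).
  rewrite L; unfold Kc; fold z.
  replace (z * Lc r t)%C with ((z - 1) * Lc r t + Lc r t)%C by ring.
  rewrite cexp_plus.
  transitivity ((z - 1) * cexp (Lc r t) * cexp ((z - 1) * Lc r t))%C; [ring | ].
  rewrite E3; ring.
Qed.

Lemma large_ellipse (A : R) :
  exists r, 0 < r /\ 1 <= sinh r /\ forall t, A <= Cmod (zc r t).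
Proof.
  (* For [r = 4 M + 3], [cosh r >= exp r / 2 >= (r + 1) / 2 = 2 M + 2], while
     [Cmod z >= (cosh r - 1) / 2]. *)
  set (M := Rmax A 1); exists (4 * M + 3).
  assert (A <= M) by apply Rmax_l; assert (1 <= M) by apply Rmax_r.
  assert (H1 : 2 * M + 1 <= cosh (4 * M + 3)).
  { assert (E := exp_ineq1_le (4 * M + 3)).
    unfold cosh; generalize (exp_pos (- (4 * M + 3))); lra. }
  split; [lra | split].
  - generalize (cosh2_sinh2 (4 * M + 3)), (sinh_gt_0 (4 * M + 3)); nra.
  - intros t; rewrite Cmod_zc; generalize (COS_bound t); lra.
Qed.

(** * Exact differentials and the residue at infinity *)

Definition null_int (f : R -> C) : Prop := is_RInt (fun t => Im (f t)) 0 PI 0.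

Lemma null_int_ext (f h : R -> C) : (forall t, f t = h t) -> null_int f -> null_int h.
Proof. intros E; apply is_RInt_ext; intros t _; now rewrite E. Qed.

Lemma null_int_plus (f h : R -> C) :
  null_int f -> null_int h -> null_int (fun t => f t + h t)%C.
Proof.
  intros F H; unfold null_int; evar_last; [apply (is_RInt_plus _ _ _ _ _ _ F H) | ].
  unfold plus; simpl; ring.
Qed.

Lemma null_int_scal (c : R) (f : R -> C) : null_int f -> null_int (fun t => RtoC c * f t)%C.
Proof.
  intros F; unfold null_int; evar_last.
  - apply (is_RInt_ext (fun t => scal c (Im (f t)))); [ | apply (is_RInt_scal _ _ _ _ _ F)].
    intros t _; rewrite im_scal_l; reflexivity.
  - unfold scal; simpl; unfold mult; simpl; ring.
Qed.

Lemma is_cderive_pow (f : R -> C) (x : R) (l : C) (n : nat) :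
  is_cderive f x l ->
  is_cderive (fun t => f t ^ S n)%C x (RtoC (INR (S n)) * f x ^ n * l)%C.
Proof.
  intros H; induction n.
  - apply (is_cderive_ext f); [intros; simpl; ring | ].
    simpl; replace (1 * 1 * l)%C with l by ring; exact H.
  - apply (is_cderive_ext (fun t => f t * f t ^ S n)%C); [reflexivity | ].
    replace (RtoC (INR (S (S n))) * f x ^ S n * l)%C
      with (l * f x ^ S n + f x * (RtoC (INR (S n)) * f x ^ n * l))%C.
    + now apply (is_cderive_mult f).
    + rewrite (S_INR (S n)), RtoC_plus; simpl (_ ^ S n)%C; ring.
Qed.

Lemma zc_real (r t : R) : sin t = 0 -> zc r t = RtoC ((1 + cosh r * cos t) / 2).
Proof. intros S; apply injective_projections; simpl; [ | rewrite S]; field. Qed.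

(** The integrand is the [t]-derivative of [z ^ S n / (n + 1)], and [z] is real at both ends of the
    half ellipse. *)
Lemma null_int_pow (r : R) (n : nat) : null_int (fun t => zc r t ^ n * uc r t)%C.
Proof.
  assert (C0 : forall t, continuous (fun t => Im (zc r t ^ n * uc r t)%C) t).
  { intros t.
    assert (H : cont2 (fun r t => zc r t ^ n * uc r t)%C r t).
    { apply cont2_mult; [ | apply cont2_uc].
      induction n; simpl; [apply cont2_const | now apply cont2_mult; [apply cont2_zc | ]]. }
    destruct H as [_ H]; now apply continuity_2d_pt_snd in H. }
  assert (P : is_RInt (fun t => INR (S n) * Im (zc r t ^ n * uc r t)%C) 0 PI 0).
  { evar_last.
    - apply (is_RInt_derive (fun t => Im (zc r t ^ S n)%C)).
      + intros t _; destruct (is_cderive_pow _ _ _ n (proj1 (is_cderive_zc r t))) as [_ H].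
        evar_last; [exact H | ].
        rewrite <- Cmult_assoc, im_scal_l; reflexivity.
      + intros t _; apply (continuous_mult (fun _ => INR (S n))); [apply continuous_const | apply C0].
    - rewrite !zc_real by auto using sin_0, sin_PI.
      rewrite <- !RtoC_pow; simpl; unfold minus, plus, opp; simpl; ring. }
  unfold null_int; evar_last.
  - apply (is_RInt_ext (fun t => scal (/ INR (S n)) (INR (S n) * Im (zc r t ^ n * uc r t)%C))).
    + intros t _.
      transitivity (/ INR (S n) * (INR (S n) * Im (zc r t ^ n * uc r t)%C)); [reflexivity | ].
      rewrite <- Rmult_assoc, Rinv_l by (apply not_0_INR; lia); apply Rmult_1_l.
    + apply (is_RInt_scal _ _ _ _ _ P).
  - unfold scal; simpl; unfold mult; simpl; ring.
Qed.

Lemma null_int_sum (r : R) (a : nat -> R) (k N : nat) :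
  null_int (fun t => sum_n (fun n => RtoC (a n) * (zc r t ^ (k - n) * uc r t))%C N).
Proof.
  induction N.
  - apply (null_int_ext (fun t => RtoC (a 0%nat) * (zc r t ^ (k - 0) * uc r t))%C).
    + intros t; now rewrite sum_O.
    + apply null_int_scal, null_int_pow.
  - apply (null_int_ext (fun t => sum_n (fun n => RtoC (a n) * (zc r t ^ (k - n) * uc r t)) N +
       RtoC (a (S N)) * (zc r t ^ (k - S N) * uc r t))%C).
    + intros t; now rewrite sum_Sn.
    + apply null_int_plus; [exact IHN | apply null_int_scal, null_int_pow].
Qed.

(* Laurent coefficient of [(Kc + 1) z^(k-1)] at [1/z]. *)
Definition residue (k : nat) : R :=
  exp 1 * acoef (S k) + match k with O => 1 | _ => 0 end.

Lemma zc_pow_inv (z : C) (k n : nat) : z <> 0 -> (n <= k)%nat ->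
  ((/ z) ^ n * z ^ k = z ^ (k - n))%C.
Proof.
  intros Hz H; replace k with (n + (k - n))%nat at 1 by lia.
  rewrite Cpow_add_r, Cpow_inv by auto; field; now apply Cpow_nz.
Qed.

Lemma Csum_mult_r (u : nat -> C) (c : C) (N : nat) :
  (sum_n u N * c = sum_n (fun n => u n * c) N)%C.
Proof. symmetry; apply (sum_n_mult_r c u N). Qed.

(** Laurent expansion at infinity: the nonnegative powers of [z] form exact differentials collected
    in [p], the [1 / z] term carries the residue, and the rest is of order [1 / z ^ 2]. *)
Lemma fc_expansion (k : nat) (r : R) : 0 < r -> 1 <= sinh r ->
  (forall t, 4 <= Cmod (zc r t)) ->
  exists (p : R -> C), null_int p /\ forall t, exists s : C, Cmod s <= 8 / 3 /\
    (fc k r t = p t + RtoC (residue k) * (/ zc r t * uc r t)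
               + RtoC (exp 1) * (/ zc r t * / zc r t * uc r t * s))%C.
Proof.
  intros Hr Hs Hz.
  exists (fun t => RtoC (exp 1) * sum_n (fun n => RtoC (acoef n) * (zc r t ^ (k - n) * uc r t)) k
    + RtoC (match k with O => 0 | _ => 1 end) * (zc r t ^ (k - 1) * uc r t))%C; split.
  { apply null_int_plus; apply null_int_scal; [apply null_int_sum | apply null_int_pow]. }
  intros t; assert (N := zc_neq_0 r t Hr).
  assert (Hv : Cmod (/ zc r t) <= / 4)
    by (rewrite Cmod_inv by auto; apply Rinv_le_contravar; [lra | auto]).
  destruct (acoef_remainder _ (S k) Hv) as (s & Bs & Es); exists s; split; [exact Bs | ].
  unfold fc; rewrite Kc_series, Es by auto; rewrite sum_Sn.
  set (z := zc r t) in *; set (u := uc r t).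
  assert (E : (sum_n (fun n => RtoC (acoef n) * (z ^ (k - n) * u)) k =
               sum_n (fun n => RtoC (acoef n) * (/ z) ^ n) k * (z ^ k * u))%C).
  { rewrite Csum_mult_r; apply sum_n_ext_loc; intros n Hn.
    rewrite <- (zc_pow_inv z k n) by auto.
    match goal with |- ?x = ?y => change (@eq C x y) end; ring. }
  rewrite E; unfold residue; rewrite RtoC_plus, RtoC_mult; change plus with Cplus.
  assert (V : ((/ z) ^ k * z ^ k = 1)%C) by (rewrite zc_pow_inv, Nat.sub_diag by auto; reflexivity).
  assert (E1 : ((/ z) ^ S k = / z * (/ z) ^ k)%C) by reflexivity.
  assert (E2 : ((/ z) ^ S (S k) = / z * (/ z * (/ z) ^ k))%C) by reflexivity.
  rewrite E1, E2.
  set (w := ((/ z) ^ k)%C) in *.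
  (* The summand [1] of [Kc + 1] contributes [z^(k-1)]: to the residue when [k = 0], to the exact
     part otherwise. For [k = 0] the truncated exponent [k - 1] comes with coefficient [0]. *)
  assert (F : (/ z * z ^ k = RtoC (match k with O => 0 | _ => 1 end) * z ^ (k - 1)
     + RtoC (match k with O => 1 | _ => 0 end) * / z)%C).
  { destruct k; simpl; [ring | ].
    rewrite Nat.sub_0_r; field; auto. }
  set (S0 := sum_n _ k).
  transitivity (RtoC (exp 1) * (S0 * (z ^ k * u))
     + RtoC (exp 1) * (RtoC (acoef (S k)) * (w * z ^ k) * / z * u)
     + RtoC (exp 1) * (/ z * / z * u * s) * (w * z ^ k)
     + (/ z * z ^ k) * u)%C.
  - field; auto.
  - rewrite V, F; ring.
Qed.

(** At infinity [z] behaves like [exp (- i tau) / 4], so its logarithmic derivative [u / z] tends to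
    [- Ci]; this turns the residue into the value of the integral. *)
Lemma uc_zc_limit (r t : R) : 0 < r -> 4 <= Cmod (zc r t) ->
  Cmod (/ zc r t * uc r t + Ci) <= / Cmod (zc r t).
Proof.
  intros Hr H; assert (N := zc_neq_0 r t Hr).
  replace (/ zc r t * uc r t + Ci)%C with (/ zc r t * (uc r t + Ci * zc r t))%C
    by (field; auto).
  rewrite Cmod_mult, Cmod_inv by auto.
  rewrite <- (Rmult_1_r (/ Cmod (zc r t))) at 2.
  apply Rmult_le_compat_l; [apply Rlt_le, Rinv_0_lt_compat; lra | ].
  assert (S := sinh_gt_0 r Hr); assert (Ch := cosh_gt_1 r Hr).
  (* The growing exponentials cancel; what is left is [i (1 + exp (i tau)) / 2], with
     [cosh r - sinh r = exp (- r)]. *)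
  replace (uc r t + Ci * zc r t)%C with (Ci * (1 + RtoC (cosh r - sinh r) *
    (cos t, sin t)) * RtoC (/ 2))%C
    by (apply injective_projections; simpl; field).
  rewrite !Cmod_mult, Cmod_R, Rabs_right by lra.
  replace (Cmod Ci) with 1
    by (unfold Cmod, Ci; simpl; replace (_ + _) with 1 by ring; now rewrite sqrt_1).
  assert (T : Cmod (1 + RtoC (cosh r - sinh r) * (cos t, sin t)) <= 2).
  { eapply Rle_trans; [apply Cmod_triangle | ].
    rewrite Cmod_mult, Cmod_1, Cmod_R.
    replace (Cmod (cos t, sin t)) with 1
      by (symmetry; apply Cmod_eq; [lra | simpl; generalize (cos2_sin2 t); simpl; lra]).
    rewrite Rabs_right; generalize (cosh2_sinh2 r); nra. }
  lra.
Qed.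

Lemma Cmod_uc_le (r t : R) : 4 <= Cmod (zc r t) -> Cmod (uc r t) <= 2 * Cmod (zc r t).
Proof.
  intros H; assert (E := Cmod_uc r t).
  assert (T : Cmod (zc r t - 1) <= Cmod (zc r t) + 1).
  { eapply Rle_trans; [apply Cmod_triangle | ]; rewrite Cmod_opp, Cmod_1; lra. }
  generalize (Cmod_ge_0 (uc r t)), (Cmod_ge_0 (zc r t - 1)); nra.
Qed.

Lemma RInt_le_const (f : R -> R) (I M : R) :
  is_RInt f 0 PI I -> (forall t, 0 < t < PI -> Rabs (f t) <= M) -> Rabs I <= PI * M.
Proof.
  intros H B; assert (Pi := PI_RGT_0).
  assert (Hc : forall c : R, is_RInt (fun _ => c) 0 PI (PI * c)).
  { intros c; evar_last; [apply is_RInt_const | ].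
    unfold scal; simpl; unfold mult; simpl; ring. }
  apply Rabs_le; split.
  - replace (- (PI * M)) with (PI * - M) by ring.
    apply (is_RInt_le (fun _ => - M) f 0 PI); auto; [lra | ].
    intros t Ht; specialize (B t Ht); apply Rabs_le_between in B; lra.
  - apply (is_RInt_le f (fun _ => M) 0 PI); auto; [lra | ].
    intros t Ht; specialize (B t Ht); apply Rabs_le_between in B; lra.
Qed.

Lemma is_RInt_fc (k : nat) (r : R) : 0 < r ->
  is_RInt (fun t => Im (fc k r t)) 0 PI (RInt (fun t => Im (fc k r t)) 0 PI).
Proof.
  intros Hr; apply (@RInt_correct R_CompleteNormedModule).
  apply (@ex_RInt_continuous R_CompleteNormedModule); intros t _.
  destruct (holomorphic_fc k) as [f' H]; destruct (H r t Hr) as (_ & _ & [_ C0] & _).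
  now apply continuity_2d_pt_snd in C0.
Qed.

(** The integral does not depend on [r], so it may be evaluated on an ellipse arbitrarily far out.
    The error is at most [PI * (M / A)] for every [A >= 4], hence zero. *)
Lemma RInt_fc (k : nat) (r : R) : 0 < r ->
  RInt (fun t => Im (fc k r t)) 0 PI = - PI * residue k.
Proof.
  intros Hr; assert (Pi := PI_RGT_0); assert (Ex := exp_pos 1).
  (* The first term is the error in [u / z]; in the second, [6] exceeds [2 * (8 / 3)], from
     [Cmod (u / z) <= 2] and [Cmod s <= 8 / 3]. *)
  set (M := Rabs (residue k) + exp 1 * 6).
  assert (HM : 0 < M) by (unfold M; generalize (Rabs_pos (residue k)); lra).
  assert (B : forall A, 4 <= A ->
    Rabs (RInt (fun t => Im (fc k r t)) 0 PI + PI * residue k) <= PI * (M / A)).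
  { intros A HA; destruct (large_ellipse A) as (r' & Hr' & Hs & Hz).
    rewrite (RInt_fc_const k r r') by auto.
    destruct (fc_expansion k r' Hr' Hs) as (p & Np & Hp);
      [intros t; apply Rle_trans with A; auto | ].
    apply (RInt_le_const (fun t => Im (fc k r' t) - Im (p t) + residue k)).
    - evar_last.
      + apply (is_RInt_plus (fun t => Im (fc k r' t) - Im (p t)) (fun _ => residue k)).
        * apply (is_RInt_minus (fun t => Im (fc k r' t)) (fun t => Im (p t)));
            [now apply is_RInt_fc | exact Np].
        * apply is_RInt_const.
      + unfold plus, minus, opp, scal; simpl; unfold plus, opp, mult; simpl; ring.
    - intros t _; destruct (Hp t) as (s & Bs & Es).
      assert (Hzt := Hz t).
      assert (N := zc_neq_0 r' t Hr').
      replace (Im (fc k r' t) - Im (p t) + residue k) with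
        (Im (RtoC (residue k) * (/ zc r' t * uc r' t + Ci)
             + RtoC (exp 1) * (/ zc r' t * / zc r' t * uc r' t * s))%C).
      2: { rewrite Es; unfold RtoC, Ci, Im; simpl; ring. }
      eapply Rle_trans; [apply Rabs_Im_le | ].
      eapply Rle_trans; [apply Cmod_triangle | ].
      rewrite !Cmod_mult, !Cmod_R, (Rabs_right (exp 1)), !Cmod_inv by (auto; lra).
      assert (B1 := uc_zc_limit r' t Hr').
      assert (B2 := Cmod_uc_le r' t).
      set (Z := Cmod (zc r' t)) in *.
      assert (B3 : / Z * / Z * Cmod (uc r' t) * Cmod s <= 6 * / Z).
      { assert (0 < / Z) by (apply Rinv_0_lt_compat; lra).
        assert (/ Z * Cmod (uc r' t) <= 2).
        { apply (Rmult_le_reg_l Z); [lra | ].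
          rewrite <- Rmult_assoc, Rinv_r, Rmult_1_l by lra.
          rewrite Rmult_comm; apply B2; lra. }
        assert (0 <= / Z * Cmod (uc r' t)) by (apply Rmult_le_pos; [lra | apply Cmod_ge_0]).
        assert (/ Z * Cmod (uc r' t) * Cmod s <= 2 * (8 / 3))
          by (apply Rmult_le_compat; auto using Cmod_ge_0).
        rewrite !Rmult_assoc, (Rmult_comm 6); apply Rmult_le_compat_l; lra. }
      apply Rle_trans with (M * / Z).
      + unfold M; rewrite Rmult_plus_distr_r, (Rmult_assoc (exp 1)).
        apply Rplus_le_compat; apply Rmult_le_compat_l;
          [apply Rabs_pos | apply B1; lra | lra | exact B3].
      + unfold Rdiv; apply Rmult_le_compat_l; [lra | ].
        apply Rinv_le_contravar; lra. }
  set (D := RInt _ 0 PI + PI * residue k) in B.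
  assert (D0 : D = 0).
  { destruct (Req_dec D 0) as [E | E]; [exact E | exfalso].
    assert (P : 0 < Rabs D) by now apply Rabs_pos_lt.
    (* Chosen so that [PI * (M / A)] is at most half of [Rabs D]. *)
    set (A := Rmax 4 (2 * PI * M / Rabs D)).
    assert (A4 : 4 <= A) by apply Rmax_l.
    assert (A5 : 2 * PI * M / Rabs D <= A) by apply Rmax_r.
    specialize (B A A4).
    apply (Rmult_le_compat_r (Rabs D)) in A5; [ | lra].
    replace (2 * PI * M / Rabs D * Rabs D) with (2 * PI * M) in A5 by (field; lra).
    apply (Rmult_le_compat_r A) in B; [ | lra].
    replace (PI * (M / A) * A) with (PI * M) in B by (field; lra).
    assert (0 < PI * M) by (apply Rmult_lt_0_compat; lra). nra. }
  unfold D in D0; lra.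
Qed.

(** * The contour on the slit *)

Lemma ln_abs_le_inv (m : R) : 0 < m <= 1 -> Rabs (ln m) <= / m.
Proof.
  intros [H0 H1].
  assert (I : 1 <= / m) by (rewrite <- Rinv_1; apply Rinv_le_contravar; lra).
  assert (L : ln m <= 0) by (rewrite <- ln_1; destruct H1 as [H1 | ->];
    [left; apply ln_increasing | right]; auto).
  rewrite Rabs_left1 by exact L; rewrite <- ln_Rinv by auto.
  generalize (exp_ineq1_le (ln (/ m))); rewrite exp_ln by lra; lra.
Qed.

Lemma ln_abs_le_1 (m : R) : / 2 <= m <= 2 -> Rabs (ln m) <= 1.
Proof.
  intros H.
  assert (E := exp_ineq1_le 1).
  assert (U : ln 2 <= 1) by (rewrite <- (ln_exp 1); apply ln_le; lra).
  assert (ln m <= ln 2) by (apply ln_le; lra).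
  assert (ln (/ 2) <= ln m) by (apply ln_le; lra).
  rewrite ln_Rinv in * by lra; apply Rabs_le; lra.
Qed.

Lemma ln_abs_le_sqrt (s : R) : 0 < s <= 1 -> Rabs (ln s) <= 2 * / sqrt s.
Proof.
  intros [H0 H1]; assert (P := sqrt_lt_R0 s H0).
  replace (ln s) with (2 * ln (sqrt s)).
  - rewrite Rabs_mult, Rabs_right by lra; apply Rmult_le_compat_l; [lra | ].
    apply ln_abs_le_inv; split; [exact P | ].
    rewrite <- sqrt_1; now apply sqrt_le_1_alt.
  - transitivity (ln (sqrt s) + ln (sqrt s)); [ring | ].
    rewrite <- ln_mult by auto; now rewrite sqrt_sqrt by lra.
Qed.

(** The value [0] for [s <= 0] makes the function continuous on the whole line, so that integrands
    built from it are continuous at the ends of the slit too. *)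
Definition xlnx (s : R) : R := if Rle_dec s 0 then 0 else s * ln s.
Definition sinc (x : R) : R := if Req_dec_T x 0 then 1 else sin x / x.

(* The continuous extension of [g s / s] to the whole line. *)
Definition gs (s : R) : R := exp (xlnx s + xlnx (1 - s)) * sinc (PI * s).

Lemma continuous_eps (f : R -> R) (x : R) :
  (forall eps, 0 < eps -> exists d, 0 < d /\ forall y, Rabs (y - x) < d -> Rabs (f y - f x) < eps) ->
  continuous f x.
Proof.
  intros H; apply filterlim_locally; intros [e He].
  destruct (H e He) as (d & Hd & B); exists (mkposreal d Hd); intros y Hy; apply B, Hy.
Qed.

Lemma eps_continuous (f : R -> R) (x : R) : continuous f x ->
  forall eps, 0 < eps -> exists d, 0 < d /\ forall y, Rabs (y - x) < d -> Rabs (f y - f x) < eps.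
Proof.
  intros H e He; destruct (proj1 (filterlim_locally _ _) H (mkposreal e He)) as [d Hd].
  exists d; split; [apply cond_pos | exact Hd].
Qed.

Lemma xlnx_bound (s : R) : Rabs s <= 1 -> Rabs (xlnx s) <= 2 * sqrt (Rabs s).
Proof.
  intros H; unfold xlnx; destruct (Rle_dec s 0) as [N | N].
  - rewrite Rabs_R0; generalize (sqrt_pos (Rabs s)); lra.
  - rewrite Rabs_right in * by lra.
    rewrite Rabs_mult, Rabs_right by lra.
    assert (P : 0 < sqrt s) by (apply sqrt_lt_R0; lra).
    apply Rle_trans with (s * (2 * / sqrt s)).
    + apply Rmult_le_compat_l; [lra | apply ln_abs_le_sqrt; lra].
    + right; rewrite <- (sqrt_sqrt s) at 1 by lra; field; lra.
Qed.

Lemma continuous_xlnx (s : R) : continuous xlnx s.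
Proof.
  destruct (Rtotal_order s 0) as [N | [-> | N]].
  - apply (continuous_ext_loc _ (fun _ => 0)); [ | apply continuous_const].
    assert (L : locally s (fun y => y < 0)) by now apply open_lt.
    eapply filter_imp; [ | exact L]; intros y Hy; unfold xlnx; destruct (Rle_dec y 0); lra.
  - apply continuous_eps; intros e He.
    set (h := Rmin 1 (e / 3)).
    assert (h <= 1) by apply Rmin_l; assert (h <= e / 3) by apply Rmin_r.
    assert (0 < h) by (apply Rmin_pos; lra).
    exists (h * h); split; [nra | ].
    intros y Hy; rewrite Rminus_0_r in Hy.
    replace (xlnx 0) with 0 by (unfold xlnx; destruct (Rle_dec 0 0); lra).
    rewrite Rminus_0_r; eapply Rle_lt_trans; [apply xlnx_bound; nra | ].
    assert (sqrt (Rabs y) <= h); [ | lra].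
    rewrite <- (sqrt_square h) by lra; apply sqrt_le_1_alt; lra.
  - apply (continuous_ext_loc _ (fun y => y * ln y)).
    + assert (L : locally s (fun y => 0 < y)) by now apply open_gt.
      eapply filter_imp; [ | exact L]; intros y Hy; unfold xlnx; destruct (Rle_dec y 0); lra.
    + apply ex_derive_continuous_R; auto_derive; lra.
Qed.

Lemma continuous_sinc (x : R) : continuous sinc x.
Proof.
  destruct (Req_dec x 0) as [-> | N].
  - apply continuous_eps; intros e He.
    assert (L := is_lim_sinc_0); apply is_lim_spec in L.
    destruct (L (mkposreal e He)) as [d Hd]; exists d; split; [apply cond_pos | ].
    intros y Hy; unfold sinc; destruct (Req_dec_T 0 0) as [_ | E]; [ | lra].
    destruct (Req_dec_T y 0) as [_ | Ny].
    + rewrite Rminus_diag, Rabs_R0; exact He.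
    + now apply Hd.
  - apply (continuous_ext_loc _ (fun y => sin y / y)).
    + assert (L : locally x (fun y => y <> 0)) by now apply open_neq.
      eapply filter_imp; [ | exact L]; intros y Hy; unfold sinc; destruct (Req_dec_T y 0); lra.
    + apply ex_derive_continuous_R; auto_derive; auto.
Qed.

Lemma continuous_gs (s : R) : continuous gs s.
Proof.
  unfold gs; apply (continuous_mult (fun s => exp (xlnx s + xlnx (1 - s)))).
  - apply continuous_exp_comp, (continuous_plus xlnx); [apply continuous_xlnx | ].
    apply (continuous_comp (fun s => 1 - s) xlnx); [ | apply continuous_xlnx].
    apply ex_derive_continuous_R; auto_derive; auto.
  - apply (continuous_comp (fun s => PI * s) sinc); [ | apply continuous_sinc].
    apply ex_derive_continuous_R; auto_derive; auto.
Qed.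

Lemma continuous_gs_pow (k : nat) (s : R) : continuous (fun s => gs s * s ^ k) s.
Proof.
  apply (continuous_mult gs); [apply continuous_gs | ].
  apply ex_derive_continuous_R; auto_derive; auto.
Qed.

Lemma gs_eq (s : R) : 0 < s < 1 ->
  gs s = exp (s * ln s + (1 - s) * ln (1 - s)) * (sin (PI * s) / (PI * s)).
Proof.
  intros H; assert (Pi := PI_RGT_0); unfold gs, xlnx, sinc.
  destruct (Rle_dec s 0); [lra | ]; destruct (Rle_dec (1 - s) 0); [lra | ].
  destruct (Req_dec_T (PI * s) 0); [nra | reflexivity].
Qed.

(* Boundary values of [Im (fc k)] on the slit. *)
Definition f0 (k : nat) (t : R) : R :=
  PI * (sin t / 2 * (gs ((1 + cos t) / 2) * ((1 + cos t) / 2) ^ k)).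

Lemma continuous_f0 (k : nat) (t : R) : continuous (f0 k) t.
Proof.
  apply (continuous_mult (fun _ => PI)); [apply continuous_const | ].
  apply (continuous_mult (fun t => sin t / 2)).
  - apply ex_derive_continuous_R; auto_derive; auto.
  - apply (continuous_comp (fun t => (1 + cos t) / 2) (fun s => gs s * s ^ k)).
    + apply ex_derive_continuous_R; auto_derive; auto.
    + apply continuous_gs_pow.
Qed.

(** Substitution [s = (1 + cos t) / 2], which reverses the orientation. *)
Lemma is_RInt_f0 (k : nat) : is_RInt (f0 k) 0 PI (PI * RInt (fun s => gs s * s ^ k) 0 1).
Proof.
  set (F := fun s => gs s * s ^ k).
  assert (C : is_RInt (fun t => scal (- sin t / 2) (F ((1 + cos t) / 2))) 0 PI (RInt F 1 0)).
  { assert (H1 : forall x, Rmin 0 PI <= x <= Rmax 0 PI -> continuous F ((1 + cos x) / 2))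
      by (intros x _; apply continuous_gs_pow).
    assert (H2 : forall x, Rmin 0 PI <= x <= Rmax 0 PI ->
      is_derive (fun t => (1 + cos t) / 2) x (- sin x / 2) /\
      continuous (fun t => - sin t / 2) x).
    { intros x _; split.
      - auto_derive; auto; field.
      - apply ex_derive_continuous_R; auto_derive; auto. }
    assert (H := @is_RInt_comp R_CompleteNormedModule F (fun t => (1 + cos t) / 2)
      (fun t => - sin t / 2) 0 PI H1 H2); cbv beta in H.
    rewrite cos_0, cos_PI in H.
    replace ((1 + 1) / 2) with 1 in H by field; replace ((1 + -1) / 2) with 0 in H by field.
    exact H. }
  apply (is_RInt_scal _ _ _ (- PI)) in C.
  assert (S : RInt F 1 0 = - RInt F 0 1).
  { symmetry; apply (opp_RInt_swap F).
    apply (@ex_RInt_continuous R_CompleteNormedModule); intros; apply continuous_gs_pow. }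
  rewrite S in C; replace (PI * RInt F 0 1) with (scal (- PI) (- RInt F 0 1))
    by (unfold scal; simpl; unfold mult; simpl; ring).
  revert C; apply is_RInt_ext; intros t _; unfold f0, F, scal; simpl; unfold mult; simpl.
  match goal with |- ?x = ?y => change (@eq R x y) end; field.
Qed.

(* The same branch of the logarithm, in a form that extends continuously to [r = 0]. *)
Definition Lx (r t : R) : C :=
  (ln (cosh r + cos t) - ln (cosh r - cos t), PI - 2 * atan (sinh r / sin t)).
Definition fx (k : nat) (r t : R) : C :=
  (((zc r t - 1) * cexp (zc r t * Lx r t) + 1) * / zc r t * zc r t ^ k * uc r t)%C.

(** The two forms of the argument agree by [atan p + atan (1 / p) = PI / 2] for [p > 0]. *)
Lemma fx_eq (k : nat) (r t : R) : 0 < r -> 0 < t < PI -> fc k r t = fx k r t.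
Proof.
  intros Hr Ht; assert (S := sinh_gt_0 r Hr); assert (0 < sin t) by (apply sin_gt_0; lra).
  unfold fc, fx, Kc; replace (Lx r t) with (Lc r t); [reflexivity | ].
  unfold Lx, Lc; f_equal.
  replace (sin t / sinh r) with (/ (sinh r / sin t)) by (field; lra).
  rewrite atan_inv by (apply Rdiv_lt_0_compat; lra); field.
Qed.

Lemma cos_bound_strict (t : R) : 0 < sin t -> -1 < cos t < 1.
Proof. intros H; generalize (cos2_sin2 t); nra. Qed.

(** With [sin t > 0] the quantities [cosh r + cos t], [cosh r - cos t] and [sin t] stay positive
    even at [r = 0], which gives continuity up to the open slit. *)
Lemma cont2_fx (k : nat) (r t : R) : 0 < sin t -> cont2 (fx k) r t.
Proof.
  intros St; assert (Cb := cos_bound_strict t St); assert (Ch := cosh_ge_1 r).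
  assert (CL : cont2 Lx r t).
  { split; unfold Lx; simpl.
    - apply continuity_2d_pt_minus; apply (continuity_2d_pt_comp1 ln); try cont2d;
        apply continuous_ln; lra.
    - apply continuity_2d_pt_minus; [cont2d | ].
      apply continuity_2d_pt_mult; [cont2d | ].
      apply (continuity_2d_pt_comp1 atan); [apply continuous_atan | ].
      apply continuity_2d_pt_mult; [cont2d | ].
      apply continuity_2d_pt_inv; [cont2d | lra]. }
  assert (Cz := cont2_zc r t).
  unfold fx; apply cont2_mult; [ | apply cont2_uc].
  apply cont2_mult.
  - apply cont2_mult.
    + apply cont2_plus; [ | apply cont2_const].
      apply cont2_mult; [ | now apply cont2_cexp, cont2_mult].
      apply (cont2_plus zc (fun _ _ => - RtoC 1)%C); [exact Cz | apply cont2_const].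
    + apply cont2_inv; [ | exact Cz].
      apply Cmod_gt_0; rewrite Cmod_zc; lra.
  - induction k; simpl; [apply cont2_const | now apply cont2_mult].
Qed.

Lemma cosh_at_0 : cosh 0 = 1.
Proof. unfold cosh; rewrite Ropp_0, exp_0; field. Qed.

Lemma sinh_at_0 : sinh 0 = 0.
Proof. unfold sinh; rewrite Ropp_0, exp_0; field. Qed.

(** On the slit the logarithm is [ln (s / (1 - s)) + i PI], whence the factor [sin (PI s)]. The
    signs of [z - 1 = - (1 - s)] and [u = - sin t / 2] cancel. *)
Lemma fx_boundary (k : nat) (t : R) : 0 < sin t -> Im (fx k 0 t) = f0 k t.
Proof.
  intros St; assert (Cb := cos_bound_strict t St); assert (Pi := PI_RGT_0).
  set (s := (1 + cos t) / 2); assert (Hs : 0 < s < 1) by (unfold s; lra).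
  assert (Z : zc 0 t = RtoC s).
  { unfold zc, s; rewrite cosh_at_0, sinh_at_0; apply injective_projections; simpl; field. }
  assert (U : uc 0 t = RtoC (- sin t / 2)).
  { unfold uc; rewrite cosh_at_0, sinh_at_0; apply injective_projections; simpl; field. }
  assert (L : Lx 0 t = (ln s - ln (1 - s), PI)).
  { unfold Lx; rewrite cosh_at_0, sinh_at_0; f_equal.
    - replace (1 + cos t) with (2 * s) by (unfold s; field).
      replace (1 - cos t) with (2 * (1 - s)) by (unfold s; field).
      rewrite !ln_mult by lra; ring.
    - unfold Rdiv; rewrite Rmult_0_l, atan_0; ring. }
  unfold fx; rewrite Z, U, L.
  assert (E : cexp (RtoC s * (ln s - ln (1 - s), PI)) =
    (exp (s * ln s - s * ln (1 - s)) * cos (PI * s), exp (s * ln s - s * ln (1 - s)) * sin (PI * s))).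
  { unfold cexp; simpl; f_equal; f_equal; f_equal; ring. }
  rewrite E, <- RtoC_inv, <- RtoC_pow by lra.
  unfold f0; fold s; rewrite gs_eq by exact Hs.
  replace (s * ln s + (1 - s) * ln (1 - s)) with (s * ln s - s * ln (1 - s) + ln (1 - s)) by ring.
  rewrite exp_plus, exp_ln by lra.
  simpl; field; lra.
Qed.

(** * Estimates at the ends of the slit *)

Lemma Cmod_cexp_m1 (w : C) : Cmod (cexp w - 1) <= 3 * Cmod w * exp (Cmod w).
Proof.
  set (m := Cmod w).
  assert (Bx := Rabs_Re_le w); assert (By := Rabs_Im_le w); fold m in Bx, By.
  assert (Hm : 0 <= m) by apply Cmod_ge_0.
  assert (X1 : exp (Re w) <= exp m).
  { destruct (Rle_lt_or_eq_dec (Re w) m);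
      [apply Rabs_le_between in Bx; lra | left; now apply exp_increasing | right; now rewrite e]. }
  assert (E1 : 1 <= exp m) by (generalize (exp_ineq1_le m); lra).
  assert (X2 : Rabs (exp (Re w) - 1) <= m * exp m).
  { apply Rabs_le_between in Bx; apply Rabs_le; split.
    - generalize (exp_ineq1_le (Re w)); nra.
    - assert (I := exp_ineq1_le (- Re w)).
      assert (P : exp (Re w) * exp (- Re w) = 1)
        by (rewrite <- exp_plus, Rplus_opp_r; apply exp_0).
      assert (Q := exp_pos (Re w)).
      assert (exp (Re w) - 1 <= Re w * exp (Re w)) by nra.
      destruct (Rle_dec 0 (Re w)); nra. }
  assert (Sn : forall y, Rabs (sin y) <= Rabs y).
  { intros y; destruct (Rle_dec 0 y) as [Hy | Hy].
    - rewrite (Rabs_right y) by lra; apply Rabs_le; split.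
      + generalize (SIN_bound y); intros.
        destruct (Rle_dec y 1); [ | lra].
        assert (0 <= sin y) by (apply sin_ge_0; generalize PI2_3_2; lra); lra.
      + destruct Hy as [Hy | <-]; [left; now apply sin_lt_x | rewrite sin_0; lra].
    - rewrite <- Rabs_Ropp, <- sin_neg, (Rabs_left y) by lra; apply Rabs_le; split.
      + generalize (SIN_bound (- y)); intros.
        destruct (Rle_dec (- y) 1); [ | lra].
        assert (0 <= sin (- y)) by (apply sin_ge_0; generalize PI2_3_2; lra); lra.
      + left; apply sin_lt_x; lra. }
  assert (X3 : Rabs (sin (Im w)) <= m) by (eapply Rle_trans; [apply Sn | exact By]).
  assert (X4 : Rabs (cos (Im w) - 1) <= m).
  { replace (Im w) with (2 * (Im w / 2)) by field.
    rewrite cos_2a_sin; set (h := Im w / 2).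
    replace (1 - 2 * sin h * sin h - 1) with (- (2 * (sin h * sin h))) by ring.
    rewrite Rabs_Ropp, Rabs_mult, Rabs_right, Rabs_mult by lra.
    assert (A1 := Sn h); assert (A2 : Rabs (sin h) <= 1) by (apply Rabs_le, SIN_bound).
    assert (A3 : Rabs h <= m / 2).
    { unfold h, Rdiv; rewrite Rabs_mult, (Rabs_right (/ 2)) by lra; lra. }
    generalize (Rabs_pos (sin h)); nra. }
  eapply Rle_trans; [apply Cmod_le_ReIm | ].
  replace (Re (cexp w - 1)%C) with ((exp (Re w) - 1) * cos (Im w) + (cos (Im w) - 1))
    by (unfold cexp; simpl; ring).
  replace (Im (cexp w - 1)%C) with (exp (Re w) * sin (Im w)) by (unfold cexp; simpl; ring).
  assert (Y1 : Rabs ((exp (Re w) - 1) * cos (Im w) + (cos (Im w) - 1)) <= m * exp m + m).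
  { eapply Rle_trans; [apply Rabs_triang | apply Rplus_le_compat; [ | exact X4]].
    rewrite Rabs_mult, <- (Rmult_1_r (m * exp m)).
    apply Rmult_le_compat; auto using Rabs_pos; apply Rabs_le, COS_bound. }
  assert (Y2 : Rabs (exp (Re w) * sin (Im w)) <= exp m * m).
  { rewrite Rabs_mult, Rabs_right by (apply Rle_ge, Rlt_le, exp_pos).
    apply Rmult_le_compat; auto using Rabs_pos; apply Rlt_le, exp_pos. }
  nra.
Qed.

Lemma exp_le_mono (x y : R) : x <= y -> exp x <= exp y.
Proof. intros [H | ->]; [left; now apply exp_increasing | right; reflexivity]. Qed.

Lemma Lc_polar (r t : R) : 0 < r -> 0 < t < PI ->
  Re (Lc r t) = ln (Cmod (zc r t)) - ln (Cmod (zc r t - 1)) /\ 0 <= Im (Lc r t) <= PI.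
Proof.
  intros Hr Ht; assert (Ch := cosh_gt_1 r Hr); assert (B := COS_bound t).
  assert (S := sinh_gt_0 r Hr); assert (St : 0 < sin t) by (apply sin_gt_0; lra).
  split.
  - rewrite Cmod_zc, Cmod_zc_1; simpl; unfold Rdiv.
    rewrite !ln_mult by lra; ring.
  - simpl; generalize (atan_bound (sin t / sinh r)); intros.
    assert (0 < atan (sin t / sinh r)); [ | lra].
    rewrite <- atan_0; apply atan_increasing, Rdiv_lt_0_compat; lra.
Qed.

Lemma Cmod_fc (k : nat) (r t : R) : 0 < r ->
  Cmod (fc k r t) = Cmod (Kc r t + 1) * / Cmod (zc r t) * Cmod (zc r t) ^ k * Cmod (uc r t).
Proof.
  intros Hr; unfold fc.
  rewrite !Cmod_mult, Cmod_pow, Cmod_inv; [reflexivity | now apply zc_neq_0].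
Qed.

(** Write [p], [q] for the moduli of [z], [z - 1], and [z = x + i y]. Near [1], [Kc] is only
    bounded: the logarithm of its modulus is [(1 - x) ln q + x ln p - y Im L], with parts at most
    [1], [2], [2]; the first uses [Rabs (1 - x) <= q]. Smallness comes from [u], of order
    [sqrt q]. *)
Lemma fc_small_near_1 (k : nat) (r t : R) : 0 < r -> sinh r <= 1 -> 0 < t < PI ->
  / 2 <= Cmod (zc r t) <= 2 -> Cmod (zc r t - 1) <= 1 ->
  Cmod (fc k r t) <= (exp 5 + 1) * 2 * 2 ^ k * (2 * sqrt (Cmod (zc r t - 1))).
Proof.
  intros Hr Hs Ht Hp Hq; rewrite Cmod_fc by auto.
  destruct (Lc_polar r t Hr Ht) as [ER EI].
  assert (St : 0 < sin t) by (apply sin_gt_0; lra).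
  assert (Q0 : 0 < Cmod (zc r t - 1)) by (apply Cmod_gt_0; now apply zc_neq_1).
  assert (U := Cmod_uc r t).
  assert (X1 : Rabs (1 - Re (zc r t)) <= Cmod (zc r t - 1)).
  { rewrite <- Rabs_Ropp; replace (- (1 - Re (zc r t))) with (Re (zc r t - 1)%C)
      by (simpl; ring); apply Rabs_Re_le. }
  assert (X2 := Rabs_Re_le (zc r t)).
  assert (Y : - / 2 <= Im (zc r t) <= 0).
  { simpl; generalize (sinh_gt_0 r Hr), (SIN_bound t); nra. }
  assert (EK : Cmod (Kc r t) = Cmod (zc r t - 1) *
    exp (Re (zc r t) * Re (Lc r t) - Im (zc r t) * Im (Lc r t)))
    by (unfold Kc; rewrite Cmod_mult, Cmod_cexp; reflexivity).
  rewrite ER in EK.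
  set (p := Cmod (zc r t)) in *; set (q := Cmod (zc r t - 1)) in *.
  set (x := Re (zc r t)) in *; set (y := Im (zc r t)) in *; set (l := Im (Lc r t)) in *.
  assert (K : Cmod (Kc r t) <= exp 5).
  { rewrite EK, <- (exp_ln q) at 1 by exact Q0; rewrite <- exp_plus; apply exp_le_mono.
    assert (T1 : (1 - x) * ln q <= 1).
    { eapply Rle_trans; [apply Rle_abs | ]; rewrite Rabs_mult.
      apply Rle_trans with (q * / q); [ | right; field; lra].
      apply Rmult_le_compat; auto using Rabs_pos; apply ln_abs_le_inv; lra. }
    assert (T2 : x * ln p <= 2).
    { eapply Rle_trans; [apply Rle_abs | ]; rewrite Rabs_mult, <- (Rmult_1_r 2).
      apply Rmult_le_compat; auto using Rabs_pos; [lra | now apply ln_abs_le_1]. }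
    assert (T3 : - y * l <= / 2 * 4) by (apply Rmult_le_compat; generalize PI_4; lra).
    nra. }
  assert (K1 : Cmod (Kc r t + 1) <= exp 5 + 1)
    by (eapply Rle_trans; [apply Cmod_triangle | rewrite Cmod_1; lra]).
  assert (P1 : / p <= 2) by (rewrite <- (Rinv_inv 2); apply Rinv_le_contravar; lra).
  assert (P2 : 0 < / p) by (apply Rinv_0_lt_compat; lra).
  assert (P3 : p ^ k <= 2 ^ k) by (apply pow_incr; lra).
  assert (P4 : 0 < p ^ k) by (apply pow_lt; lra).
  assert (U1 : Cmod (uc r t) <= 2 * sqrt q).
  { apply Rsqr_incr_0_var; [ | generalize (sqrt_pos q); lra].
    unfold Rsqr; replace (2 * sqrt q * (2 * sqrt q)) with (4 * (sqrt q * sqrt q)) by ring.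
    rewrite sqrt_sqrt by lra; nra. }
  assert (0 < (/ p) * p ^ k) by nra.
  apply Rmult_le_compat; try apply Cmod_ge_0; auto.
  - repeat apply Rmult_le_pos; try lra; apply Cmod_ge_0.
  - apply Rmult_le_compat; try lra.
    + apply Rmult_le_pos; [apply Cmod_ge_0 | lra].
    + apply Rmult_le_compat; try lra; apply Cmod_ge_0.
Qed.

(** Here [Kc + 1 = z + (z - 1) (exp (z L) - 1)] is of order [p |ln p|], with [p] the modulus of [z].
    With [m] the fourth root of [p], [|ln p| <= 4 / m] gives order [m^3]; dividing by [z] costs
    [m^4] and [u] gains [m^2], which leaves [m]. The analogous bound by a square root would leave no
    positive power. *)
Lemma fc_small_near_0 (k : nat) (r t : R) : 0 < r -> 0 < t < PI ->
  Cmod (zc r t) <= 1 -> / 2 <= Cmod (zc r t - 1) <= 2 ->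
  Cmod (fc k r t) <= (1 + 54 * exp 9) * 2 * sqrt (sqrt (Cmod (zc r t))).
Proof.
  intros Hr Ht Hp Hq; rewrite Cmod_fc by auto.
  destruct (Lc_polar r t Hr Ht) as [ER EI].
  assert (P0 : 0 < Cmod (zc r t)) by (apply Cmod_gt_0; now apply zc_neq_0).
  assert (U := Cmod_uc r t).
  assert (EK : Cmod (Kc r t + 1) <= Cmod (zc r t) +
    Cmod (zc r t - 1) * Cmod (cexp (zc r t * Lc r t) - 1)).
  { replace (Kc r t + 1)%C with (zc r t + (zc r t - 1) * (cexp (zc r t * Lc r t) - 1))%C
      by (unfold Kc; ring).
    eapply Rle_trans; [apply Cmod_triangle | rewrite Cmod_mult; lra]. }
  assert (EW := Cmod_cexp_m1 (zc r t * Lc r t)%C); rewrite Cmod_mult in EW.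
  assert (EL := Cmod_le_ReIm (Lc r t)); rewrite ER in EL.
  rewrite (Rabs_right (Im (Lc r t))) in EL by lra.
  set (p := Cmod (zc r t)) in *; set (q := Cmod (zc r t - 1)) in *.
  set (m := sqrt (sqrt p)).
  assert (S0 : 0 < sqrt p) by now apply sqrt_lt_R0.
  assert (M0 : 0 < m) by now apply sqrt_lt_R0.
  assert (M2 : m * m = sqrt p) by (apply sqrt_sqrt; lra).
  assert (M4 : p = m * m * (m * m)) by (rewrite M2, sqrt_sqrt; lra).
  assert (M1 : m <= 1).
  { destruct (Rle_dec m 1) as [H | H]; [exact H | exfalso].
    assert (1 < m * m) by nra; nra. }
  assert (Lp : Rabs (ln p) <= 4 * / m).
  { rewrite M4, !ln_mult by nra.
    replace (ln m + ln m + (ln m + ln m)) with (4 * ln m) by ring.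
    rewrite Rabs_mult, Rabs_right by lra; apply Rmult_le_compat_l; [lra | ].
    apply ln_abs_le_inv; lra. }
  assert (LL : Cmod (Lc r t) <= 4 * / m + 5).
  { eapply Rle_trans; [exact EL | ].
    assert (Rabs (ln p - ln q) <= Rabs (ln p) + Rabs (ln q))
      by (eapply Rle_trans; [apply Rabs_triang | rewrite Rabs_Ropp; lra]).
    assert (Rabs (ln q) <= 1) by now apply ln_abs_le_1.
    generalize PI_4; lra. }
  assert (W : p * Cmod (Lc r t) <= 9 * (m * m * m)).
  { apply Rle_trans with (p * (4 * / m + 5)); [apply Rmult_le_compat_l; lra | ].
    replace (p * (4 * / m + 5)) with (m * m * m * (4 + 5 * m)) by (rewrite M4; field; lra).
    rewrite Rmult_comm; apply Rmult_le_compat_r; [ | lra].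
    repeat apply Rmult_le_pos; lra. }
  assert (M3 : 0 < m * m * m <= m * m).
  { split; [repeat apply Rmult_lt_0_compat; lra | ].
    rewrite <- (Rmult_1_r (m * m)) at 2; apply Rmult_le_compat_l; nra. }
  assert (EW2 : Cmod (cexp (zc r t * Lc r t) - 1) <= 3 * (9 * (m * m * m)) * exp 9).
  { eapply Rle_trans; [exact EW | ].
    assert (0 <= p * Cmod (Lc r t)) by (apply Rmult_le_pos; [lra | apply Cmod_ge_0]).
    apply Rmult_le_compat; try lra; [apply Rlt_le, exp_pos | ].
    apply exp_le_mono; nra. }
  assert (E9 := exp_pos 9).
  assert (K1 : Cmod (Kc r t + 1) <= (1 + 54 * exp 9) * (m * m * m)).
  { eapply Rle_trans; [exact EK | ].
    assert (q * Cmod (cexp (zc r t * Lc r t) - 1) <= 2 * (3 * (9 * (m * m * m)) * exp 9))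
      by (apply Rmult_le_compat; try lra; apply Cmod_ge_0).
    assert (p <= m * m * m); [ | lra].
    rewrite M4; replace (m * m * (m * m)) with (m * m * m * m) by ring.
    rewrite <- (Rmult_1_r (m * m * m)) at 2; apply Rmult_le_compat_l; lra. }
  assert (U1 : Cmod (uc r t) <= 2 * (m * m)).
  { apply Rsqr_incr_0_var; [ | nra]; unfold Rsqr.
    replace (2 * (m * m) * (2 * (m * m))) with (4 * p) by (rewrite M4; ring); nra. }
  assert (Pk : p ^ k <= 1) by (rewrite <- (pow1 k); apply pow_incr; lra).
  assert (Pk0 : 0 < p ^ k) by (apply pow_lt; lra).
  assert (I0 : 0 < / p) by (apply Rinv_0_lt_compat; lra).
  replace ((1 + 54 * exp 9) * 2 * m)
    with ((1 + 54 * exp 9) * (m * m * m) * / p * 1 * (2 * (m * m)))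
    by (rewrite M4; field; lra).
  assert (0 <= Cmod (Kc r t + 1)) by apply Cmod_ge_0.
  assert (0 <= Cmod (Kc r t + 1) * / p) by (apply Rmult_le_pos; lra).
  apply Rmult_le_compat; auto using Cmod_ge_0.
  - apply Rmult_le_pos; lra.
  - apply Rmult_le_compat; try lra.
    apply Rmult_le_compat; lra.
Qed.

Lemma cos_near (t0 c : R) : cos t0 = c -> forall e, 0 < e ->
  exists d, 0 < d /\ forall t, Rabs (t - t0) < d -> Rabs (cos t - c) < e.
Proof. intros <-; apply (eps_continuous cos), continuous_cos. Qed.

Lemma small_ellipse (e : R) : 0 < e ->
  exists d, 0 < d /\ forall r, 0 < r < d -> cosh r - 1 < e /\ sinh r <= 1.
Proof.
  intros He.
  destruct (eps_continuous cosh 0) with (eps := e) as (d1 & Hd1 & B1);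
    [apply ex_derive_continuous_R; auto_derive; auto | exact He | ].
  destruct (eps_continuous sinh 0) with (eps := 1) as (d2 & Hd2 & B2);
    [apply ex_derive_continuous_R; auto_derive; auto | lra | ].
  exists (Rmin d1 d2); split; [now apply Rmin_pos | intros r Hr].
  assert (Rmin d1 d2 <= d1) by apply Rmin_l; assert (Rmin d1 d2 <= d2) by apply Rmin_r.
  specialize (B1 r); specialize (B2 r).
  rewrite Rminus_0_r, Rabs_right in B1, B2 by lra.
  rewrite cosh_at_0 in B1; rewrite sinh_at_0 in B2.
  split; [assert (T := B1 ltac:(lra)) | assert (T := B2 ltac:(lra))]; apply Rabs_def2 in T; lra.
Qed.

(** At [r = 0] the ends [t = 0] and [t = PI] are the points [z = 1] and [z = 0], which [cont2_fx]
    does not reach. *)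
Lemma fc_small_corners (k : nat) (e : R) : 0 < e ->
  exists d, 0 < d /\ forall r t, 0 < r < d -> 0 < t < PI -> (t < d \/ PI - d < t) ->
  Cmod (fc k r t) <= e.
Proof.
  intros He.
  set (M := (exp 5 + 1) * 2 * 2 ^ k * 2 + (1 + 54 * exp 9) * 2).
  assert (E5 := exp_pos 5); assert (E9 := exp_pos 9); assert (P2 := pow_2_ge_1 k).
  assert (M1 : 0 <= (exp 5 + 1) * 2 * 2 ^ k * 2) by (repeat apply Rmult_le_pos; lra).
  assert (HM : 0 < M) by (unfold M; lra).
  set (h := Rmin (/ 2) (e / M)).
  assert (h <= / 2) by apply Rmin_l; assert (Hh : h <= e / M) by apply Rmin_r.
  assert (0 < h) by (apply Rmin_pos; [lra | now apply Rdiv_lt_0_compat]).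
  assert (HMh : M * h <= e).
  { apply (Rmult_le_compat_l M) in Hh; [ | lra].
    replace (M * (e / M)) with e in Hh by (field; lra); exact Hh. }
  (* The fourth power undoes the nested square roots of the bound near [0]. *)
  set (h4 := h * h * (h * h)).
  assert (h2 : 0 < h * h <= / 4) by (split; nra).
  assert (H4 : 0 < h4 <= / 16) by (unfold h4; split; nra).
  destruct (cos_near 0 1 cos_0 h4) as (d1 & Hd1 & B1); [lra | ].
  destruct (cos_near PI (-1) cos_PI h4) as (d2 & Hd2 & B2); [lra | ].
  destruct (small_ellipse h4) as (d3 & Hd3 & B3); [lra | ].
  exists (Rmin d1 (Rmin d2 d3)).
  assert (D1 : Rmin d1 (Rmin d2 d3) <= d1) by apply Rmin_l.
  assert (D2 : Rmin d1 (Rmin d2 d3) <= Rmin d2 d3) by apply Rmin_r.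
  assert (D3 : Rmin d2 d3 <= d2) by apply Rmin_l.
  assert (D4 : Rmin d2 d3 <= d3) by apply Rmin_r.
  split; [repeat apply Rmin_pos; auto | ].
  intros r t Hr Ht [T | T].
  - destruct (B3 r) as [Cr Sr]; [lra | ].
    assert (Ct := B1 t); rewrite Rminus_0_r, Rabs_right in Ct by lra.
    specialize (Ct ltac:(lra)); apply Rabs_def2 in Ct.
    assert (Ch := cosh_ge_1 r); assert (Cb := COS_bound t).
    eapply Rle_trans; [apply fc_small_near_1; try rewrite Cmod_zc; try rewrite Cmod_zc_1; lra | ].
    assert (Q : sqrt (Cmod (zc r t - 1)) <= h).
    { rewrite <- (sqrt_square h) by lra; apply sqrt_le_1_alt.
      rewrite Cmod_zc_1; assert (h4 <= h * h) by (unfold h4; nra); lra. }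
    assert ((exp 5 + 1) * 2 * 2 ^ k * 2 * sqrt (Cmod (zc r t - 1)) <=
            (exp 5 + 1) * 2 * 2 ^ k * 2 * h) by (apply Rmult_le_compat_l; lra).
    unfold M in HMh; nra.
  - destruct (B3 r) as [Cr Sr]; [lra | ].
    assert (Ct := B2 t); rewrite Rabs_left in Ct by lra.
    specialize (Ct ltac:(lra)); apply Rabs_def2 in Ct.
    assert (Ch := cosh_ge_1 r); assert (Cb := COS_bound t).
    eapply Rle_trans; [apply fc_small_near_0; try rewrite Cmod_zc; try rewrite Cmod_zc_1; lra | ].
    assert (Q : sqrt (sqrt (Cmod (zc r t))) <= h).
    { rewrite <- (sqrt_square h) by lra; apply sqrt_le_1_alt.
      rewrite <- (sqrt_square (h * h)) by lra; apply sqrt_le_1_alt.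
      rewrite Cmod_zc; unfold h4 in *; lra. }
    assert ((1 + 54 * exp 9) * 2 * sqrt (sqrt (Cmod (zc r t))) <= (1 + 54 * exp 9) * 2 * h)
      by (apply Rmult_le_compat_l; lra).
    unfold M in HMh; nra.
Qed.

Lemma f0_small_corners (k : nat) (e : R) : 0 < e ->
  exists d, 0 < d /\ forall t, 0 < t < PI -> (t < d \/ PI - d < t) -> Rabs (f0 k t) <= e.
Proof.
  intros He.
  destruct (eps_continuous (f0 k) 0 (continuous_f0 k 0) e He) as (d1 & H1 & B1).
  destruct (eps_continuous (f0 k) PI (continuous_f0 k PI) e He) as (d2 & H2 & B2).
  assert (Z1 : f0 k 0 = 0) by (unfold f0; rewrite sin_0; unfold Rdiv; ring).
  assert (Z2 : f0 k PI = 0) by (unfold f0; rewrite sin_PI; unfold Rdiv; ring).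
  rewrite Z1 in B1; rewrite Z2 in B2.
  exists (Rmin d1 d2); split; [now apply Rmin_pos | ].
  assert (Rmin d1 d2 <= d1) by apply Rmin_l; assert (Rmin d1 d2 <= d2) by apply Rmin_r.
  intros t Ht [T | T].
  - specialize (B1 t); rewrite !Rminus_0_r, (Rabs_right t) in B1 by lra.
    left; apply B1; lra.
  - specialize (B2 t); rewrite !Rminus_0_r, (Rabs_left (t - PI)) in B2 by lra.
    left; apply B2; lra.
Qed.

(** Near both ends of the interval the form and its boundary value are each at most [e / 2]; in
    between, [fx] is uniformly continuous on a compact rectangle that includes [r = 0]. *)
Lemma fc_boundary_limit (k : nat) (e : R) : 0 < e ->
  exists d, 0 < d /\ forall r t, 0 < r < d -> 0 < t < PI -> Rabs (Im (fc k r t) - f0 k t) <= e.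
Proof.
  intros He.
  destruct (fc_small_corners k (e / 2)) as (d1 & H1 & B1); [lra | ].
  destruct (f0_small_corners k (e / 2)) as (d2 & H2 & B2); [lra | ].
  set (n := Rmin d1 d2); assert (Hn : 0 < n) by now apply Rmin_pos.
  assert (N1 : n <= d1) by apply Rmin_l; assert (N2 : n <= d2) by apply Rmin_r.
  destruct (uniform_continuity_2d (fun r t => Im (fx k r t)) 0 1 n (PI - n)) with
    (eps := mkposreal e He) as [[d3 H3] B3].
  { intros r t _ Ht; apply cont2_fx, sin_gt_0; lra. }
  simpl in B3.
  exists (Rmin n (Rmin d3 1)); split; [repeat apply Rmin_pos; lra | ].
  assert (D1 : Rmin n (Rmin d3 1) <= n) by apply Rmin_l.
  assert (D2 : Rmin n (Rmin d3 1) <= Rmin d3 1) by apply Rmin_r.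
  assert (D3 : Rmin d3 1 <= d3) by apply Rmin_l.
  assert (D4 : Rmin d3 1 <= 1) by apply Rmin_r.
  intros r t Hr Ht.
  destruct (Rlt_dec t n) as [L | L]; [ | destruct (Rlt_dec (PI - n) t) as [G | G]].
  1, 2: eapply Rle_trans; [apply Rabs_triang | ]; rewrite Rabs_Ropp;
    replace e with (e / 2 + e / 2) by field; apply Rplus_le_compat;
    [eapply Rle_trans; [apply Rabs_Im_le | apply B1; lra] | apply B2; lra].
  rewrite fx_eq, <- fx_boundary by (auto; try apply sin_gt_0; lra).
  left; apply B3; try lra.
  - rewrite Rminus_0_r, Rabs_right; lra.
  - rewrite Rminus_diag, Rabs_R0; exact H3.
Qed.

(** One integral, constant in [r], is evaluated twice: large ellipses give [- PI * residue k],
    shrinking ones [PI] times the moment. A nonzero discrepancy is refuted by approximating the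
    boundary values within half of it. *)
Lemma moment_gs (k : nat) : RInt (fun s => gs s * s ^ k) 0 1 = - residue k.
Proof.
  assert (Pi := PI_RGT_0).
  set (I := RInt (fun s => gs s * s ^ k) 0 1).
  destruct (Req_dec (I + residue k) 0) as [E | E]; [lra | exfalso].
  assert (P : 0 < Rabs (I + residue k)) by now apply Rabs_pos_lt.
  destruct (fc_boundary_limit k (Rabs (I + residue k) / 2)) as (d & Hd & B); [lra | ].
  assert (J := RInt_le_const (fun t => Im (fc k (d / 2) t) - f0 k t)
    (- PI * residue k - PI * I) (Rabs (I + residue k) / 2)).
  assert (Rabs (- PI * residue k - PI * I) <= PI * (Rabs (I + residue k) / 2)).
  { apply J.
    - apply (is_RInt_minus (fun t => Im (fc k (d / 2) t)) (f0 k)); [ | apply is_RInt_f0].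
      rewrite <- (RInt_fc k (d / 2)) by lra; apply is_RInt_fc; lra.
    - intros t Ht; apply B; lra. }
  replace (- PI * residue k - PI * I) with (- (PI * (I + residue k))) in * by ring.
  rewrite Rabs_Ropp, Rabs_mult, Rabs_right in * by lra; nra.
Qed.

(** * Positivity *)

(* Integration against [delta_0 + g(s)/s ds]: its moments are the [e b_k]. *)
Definition Lmu (P : R -> R) : R := P 0 + RInt (fun s => gs s * P s) 0 1.

Lemma ex_RInt_gs (P : R -> R) :
  (forall s, continuous P s) -> ex_RInt (fun s => gs s * P s) 0 1.
Proof.
  intros H; apply (@ex_RInt_continuous R_CompleteNormedModule); intros s _.
  apply (continuous_mult gs); [apply continuous_gs | apply H].
Qed.

Lemma Lmu_ext (P Q : R -> R) : (forall s, P s = Q s) -> Lmu P = Lmu Q.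
Proof.
  intros E; unfold Lmu; rewrite E; f_equal; apply RInt_ext; intros; now rewrite E.
Qed.

Lemma Lmu_plus (P Q : R -> R) :
  (forall s, continuous P s) -> (forall s, continuous Q s) ->
  Lmu (fun s => P s + Q s) = Lmu P + Lmu Q.
Proof.
  intros HP HQ; unfold Lmu.
  rewrite (RInt_ext _ (fun s => gs s * P s + gs s * Q s)) by (intros; simpl; ring).
  assert (E := RInt_plus (fun s => gs s * P s) (fun s => gs s * Q s) 0 1
    (ex_RInt_gs P HP) (ex_RInt_gs Q HQ)).
  unfold plus in E; simpl in E; rewrite E; ring.
Qed.

Lemma Lmu_scal (c : R) (P : R -> R) :
  (forall s, continuous P s) -> Lmu (fun s => c * P s) = c * Lmu P.
Proof.
  intros HP; unfold Lmu.
  rewrite (RInt_ext _ (fun s => c * (gs s * P s))) by (intros; simpl; ring).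
  assert (E := RInt_scal (fun s => gs s * P s) 0 1 c (ex_RInt_gs P HP)).
  unfold scal in E; simpl in E; unfold mult in E; simpl in E; rewrite E; ring.
Qed.

Lemma gs_pos (s : R) : 0 < s < 1 -> 0 <= gs s.
Proof.
  intros H; rewrite gs_eq by exact H; assert (Pi := PI_RGT_0).
  apply Rmult_le_pos; [apply Rlt_le, exp_pos | ].
  apply Rlt_le, Rdiv_lt_0_compat; [apply sin_gt_0; nra | nra].
Qed.

Lemma Lmu_le (P Q : R -> R) :
  (forall s, continuous P s) -> (forall s, continuous Q s) ->
  (forall s, 0 <= s <= 1 -> P s <= Q s) -> Lmu P <= Lmu Q.
Proof.
  intros HP HQ H; unfold Lmu; apply Rplus_le_compat; [apply H; lra | ].
  apply RInt_le; auto using ex_RInt_gs; [lra | ].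
  intros s Hs; apply Rmult_le_compat_l; [now apply gs_pos | apply H; lra].
Qed.

(** For [k = 0] the atom contributes [0 ^ 0 = 1] and cancels the extra [1] in [residue 0]; for
    [k > 0] neither is present. *)
Lemma Lmu_pow (k : nat) : Lmu (fun s => s ^ k) = exp 1 * b (S k).
Proof.
  unfold Lmu; rewrite moment_gs; unfold residue.
  change (acoef (S k)) with (- b (S k)).
  destruct k; [simpl pow | rewrite pow_i by lia]; ring.
Qed.

Lemma g_gs (s : R) : 0 < s < 1 -> g s = s * gs s.
Proof.
  intros H; assert (Pi := PI_RGT_0); rewrite gs_eq by exact H; unfold g.
  destruct (Rlt_dec 0 s); [ | lra]; destruct (Rlt_dec s 1); [ | lra].
  unfold Rpower; rewrite exp_plus; field; lra.
Qed.

(** For [k > 0] this is the definition of [d] rescaled by [12 ^ k]: [(-1) ^ k] is the contribution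
    of the atom, and [g t / t] is [gs t]. For [k = 0] it rests on [d 1 = b 1]. *)
Lemma Lmu_shifted_pow (k : nat) : Lmu (fun s => (s - / 12) ^ k) = exp 1 * d (S k).
Proof.
  destruct k as [ | k].
  { rewrite (Lmu_ext _ (fun s => s ^ 0)) by reflexivity; rewrite Lmu_pow; reflexivity. }
  unfold Lmu, d; replace (S (S k) - 1)%nat with (S k) by lia.
  set (n := S k).
  assert (E12 : 12 ^ n <> 0) by (apply pow_nonzero; lra).
  rewrite (RInt_ext (fun t => (12 * t - 1) ^ n / t * g t)
    (fun t => 12 ^ n * (gs t * (t - / 12) ^ n))).
  - assert (C : forall s, continuous (fun s => (s - / 12) ^ n) s)
      by (intros; apply ex_derive_continuous_R; auto_derive; auto).
    assert (E := RInt_scal (fun s => gs s * (s - / 12) ^ n) 0 1 (12 ^ n) (ex_RInt_gs _ C)).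
    change (RInt (fun s => 12 ^ n * (gs s * (s - / 12) ^ n)) 0 1 =
      12 ^ n * RInt (fun s => gs s * (s - / 12) ^ n) 0 1) in E; rewrite E.
    replace ((-1) ^ n) with (12 ^ n * (0 - / 12) ^ n)
      by (rewrite <- Rpow_mult_distr; f_equal; field).
    field; split; [ | exact E12]; apply Rgt_not_eq, exp_pos.
  - rewrite Rmin_left, Rmax_right by lra; intros t Ht; rewrite g_gs by exact Ht.
    replace (12 * t - 1) with (12 * (t - / 12)) by field.
    rewrite Rpow_mult_distr; match goal with |- ?p = ?q => change (@eq R p q) end; field; lra.
Qed.

(** * The difference of the partial sums as an integral *)

Definition Dsum (y u : R) (N : nat) (s : R) : R :=
  sum_f_R0 (fun i => / u ^ S i * (s - / 12) ^ i - / y ^ S i * s ^ i) N.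

Lemma continuous_Dterm (y u : R) (i : nat) (s : R) :
  continuous (fun s => / u ^ S i * (s - / 12) ^ i - / y ^ S i * s ^ i) s.
Proof. apply ex_derive_continuous_R; auto_derive; auto. Qed.

Lemma continuous_Dsum (y u : R) (N : nat) (s : R) : continuous (Dsum y u N) s.
Proof.
  induction N; [apply (continuous_Dterm y u 0) | ].
  apply (continuous_plus (Dsum y u N)); [exact IHN | apply continuous_Dterm].
Qed.

Lemma Lmu_Dsum (x : R) (N : nat) :
  Lmu (Dsum (1 + x) (x + 11 / 12) N) = exp 1 * (S_m (S N) x - sigma_m (S N) x).
Proof.
  assert (T : forall i, Lmu (fun s => / (x + 11 / 12) ^ S i * (s - / 12) ^ i - / (1 + x) ^ S i * s ^ i)
    = exp 1 * (d (S i) / (x + 11 / 12) ^ S i - b (S i) / (1 + x) ^ S i)).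
  { intros i.
    rewrite (Lmu_ext _ (fun s => / (x + 11 / 12) ^ S i * (s - / 12) ^ i +
                                 (- / (1 + x) ^ S i) * s ^ i)) by (intros; ring).
    rewrite (Lmu_plus (fun s => / (x + 11 / 12) ^ S i * (s - / 12) ^ i)
               (fun s => - / (1 + x) ^ S i * s ^ i))
      by (intros; apply ex_derive_continuous_R; auto_derive; auto).
    rewrite (Lmu_scal _ (fun s => (s - / 12) ^ i)), (Lmu_scal _ (fun s => s ^ i))
      by (intros; apply ex_derive_continuous_R; auto_derive; auto).
    rewrite Lmu_shifted_pow, Lmu_pow; unfold Rdiv; ring. }
  unfold S_m, sigma_m; replace (S N - 1)%nat with N by lia.
  induction N; [apply (T 0%nat) | ].
  rewrite (Lmu_ext _ (fun s => Dsum (1 + x) (x + 11 / 12) N s +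
    (/ (x + 11 / 12) ^ S (S N) * (s - / 12) ^ S N - / (1 + x) ^ S (S N) * s ^ S N)))
    by reflexivity.
  rewrite Lmu_plus by (intros; apply continuous_Dsum || apply continuous_Dterm).
  rewrite IHN, T, !tech5; ring.
Qed.

Lemma geom_sum_inv (y s : R) (N : nat) : y <> 0 ->
  (y - s) * sum_f_R0 (fun i => / y ^ S i * s ^ i) N = 1 - (s / y) ^ S N.
Proof.
  intros Hy; induction N.
  - simpl; field; auto.
  - rewrite tech5, Rmult_plus_distr_l, IHN.
    unfold Rdiv; rewrite !Rpow_mult_distr, !pow_inv by auto.
    simpl; field; split; auto; now apply pow_nonzero.
Qed.

(** Since [y - s = (y - / 12) - (s - / 12)], both geometric sums have the same denominator and their
    leading [1]s cancel. This is where the shift by [1 / 12] in both variable and node is used. *)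
Lemma Dsum_eq (y s : R) (N : nat) : 1 < y ->
  (y - s) * Dsum y (y - / 12) N s = (s / y) ^ S N - ((s - / 12) / (y - / 12)) ^ S N.
Proof.
  intros Hy.
  assert (E : Dsum y (y - / 12) N s =
    sum_f_R0 (fun i => / (y - / 12) ^ S i * (s - / 12) ^ i) N -
    sum_f_R0 (fun i => / y ^ S i * s ^ i) N) by apply minus_sum.
  rewrite E, Rmult_minus_distr_l, geom_sum_inv by lra.
  replace (y - s) with ((y - / 12) - (s - / 12)) by ring.
  rewrite geom_sum_inv by lra; ring.
Qed.

Lemma pow_diff_ge (a c : R) (n : nat) : 0 <= c <= a ->
  (a - c) * a ^ n <= a ^ S n - c ^ S n.
Proof.
  intros H; assert (c ^ n <= a ^ n) by (apply pow_incr; lra); simpl; nra.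
Qed.

(** The cofactor, the sum of all [c^i a^(n-i)], is dominated by the binomial expansion of
    [(a + c)^n]. This form has no constant depending on [n] and suits a bound on a sum of
    squares. *)
Lemma pow_diff_le (a c : R) (n : nat) : 0 <= a <= c ->
  c ^ S n - a ^ S n <= (c - a) * (a + c) ^ n.
Proof.
  intros H; induction n; [simpl; lra | ].
  assert (E1 : a ^ S n <= a * (a + c) ^ n).
  { simpl; apply Rmult_le_compat_l; [lra | apply pow_incr; lra]. }
  replace (c ^ S (S n) - a ^ S (S n)) with (c * (c ^ S n - a ^ S n) + a ^ S n * (c - a))
    by (simpl; ring).
  replace ((c - a) * (a + c) ^ S n)
    with (c * ((c - a) * (a + c) ^ n) + a * (a + c) ^ n * (c - a)) by (simpl; ring).
  apply Rplus_le_compat; [apply Rmult_le_compat_l | apply Rmult_le_compat_r]; lra.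
Qed.

(* On [0, 1] its only sign change is at [s = y / (12 y - 1)], to the right of which
   [s / y] exceeds [(1 / 12) / (y - 1 / 12)], the modulus of the second ratio at [s = 0].
   A linear minorant would not do: the mean of [mu] is exactly [1 / 12], as [d_2 = 0]. *)
Definition Lq (y s : R) : R :=
  y * s * (s - y / (12 * y - 1)) + (y - / 12) * s - y / 12.

Lemma Lq_factor (y s : R) : 1 < y ->
  Lq y s = (s - y / (12 * y - 1)) * (y * s + (y - / 12)).
Proof. intros Hy; unfold Lq; field; lra. Qed.

(** Compare the case of squares with the general one: [A^2 - B^2 = (A - B) w Nn] with [Nn] linear in
    [s], and [Lq <= Nn] on [[0, 1]]. The higher powers multiply this difference by a cofactor to be
    compared with [B0 ^ (2 * n)]: from above where the difference is negative, from below where it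
    is positive. *)
Lemma even_power_minorant (y s : R) (n : nat) : 1 < y -> 0 <= s <= 1 ->
  (/ 12 / (y - / 12)) ^ (2 * n) * (/ 12 * (y - s) / (y * (y - / 12)) ^ 2) * Lq y s
  <= (s / y) ^ (2 * S n) - ((s - / 12) / (y - / 12)) ^ (2 * S n).
Proof.
  intros Hy Hs.
  set (A := s / y); set (B := (s - / 12) / (y - / 12)); set (B0 := / 12 / (y - / 12)).
  assert (A0 : 0 <= A) by (apply Rmult_le_pos; [lra | apply Rlt_le, Rinv_0_lt_compat; lra]).
  assert (B0p : 0 < B0) by (apply Rdiv_lt_0_compat; lra).
  set (w := / (y * (y - / 12))).
  assert (Hw : 0 < w) by (apply Rinv_0_lt_compat; nra).
  assert (Em : A - B = / 12 * (y - s) * w) by (unfold A, B, w; field; lra).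
  assert (Ep : A + B = (2 * s * y - s / 12 - y / 12) * w) by (unfold A, B, w; field; lra).
  set (Nn := 2 * s * y - s / 12 - y / 12) in *.
  assert (Ew : / 12 * (y - s) / (y * (y - / 12)) ^ 2 = (A - B) * w)
    by (rewrite Em; unfold w; field; lra).
  rewrite Ew, !pow_mult.
  assert (Hm : 0 < A - B) by (rewrite Em; repeat apply Rmult_lt_0_compat; lra).
  assert (s1p : 0 < y / (12 * y - 1)) by (apply Rdiv_lt_0_compat; lra).
  assert (NL : Lq y s <= Nn).
  { unfold Lq, Nn; assert (0 <= y * s * (1 - s + y / (12 * y - 1)))
      by (repeat apply Rmult_le_pos; lra); lra. }
  assert (Eab : A ^ 2 - B ^ 2 = (A - B) * w * Nn)
    by (replace (A ^ 2 - B ^ 2) with ((A - B) * (A + B)) by ring; rewrite Ep; ring).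
  assert (Hmw : 0 < (A - B) * w) by now apply Rmult_lt_0_compat.
  assert (P0 : 0 < (B0 ^ 2) ^ n) by (apply pow_lt, pow_lt, B0p).
  assert (LL : (A - B) * w * Lq y s <= A ^ 2 - B ^ 2)
    by (rewrite Eab; apply Rmult_le_compat_l; lra).
  rewrite Rmult_assoc.
  (* If [Nn <= 0], then [B <= - A <= 0], so [A^2 + B^2 <= (A - B)^2 <= B0^2], which bounds the
     cofactor. *)
  destruct (Rle_dec Nn 0) as [Hn | Hn].
  - assert (Hp : A + B <= 0) by (rewrite Ep; nra).
    assert (AB : A - B <= B0).
    { rewrite Em; unfold w, B0.
      replace (/ 12 / (y - / 12)) with (/ 12 * y * / (y * (y - / 12))) by (field; lra).
      apply Rmult_le_compat_r; [apply Rlt_le, Hw | lra]. }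
    assert (D : A ^ 2 <= B ^ 2) by nra.
    assert (S : A ^ 2 + B ^ 2 <= B0 ^ 2) by nra.
    assert (T := pow_diff_le (A ^ 2) (B ^ 2) n (conj (pow2_ge_0 A) D)).
    assert (T2 : (A ^ 2 + B ^ 2) ^ n <= (B0 ^ 2) ^ n)
      by (apply pow_incr; generalize (pow2_ge_0 A), (pow2_ge_0 B); lra).
    assert (T3 : (B ^ 2 - A ^ 2) * (A ^ 2 + B ^ 2) ^ n <= (B ^ 2 - A ^ 2) * (B0 ^ 2) ^ n)
      by (apply Rmult_le_compat_l; lra).
    assert (T4 : (B0 ^ 2) ^ n * ((A - B) * w * Lq y s) <= (B0 ^ 2) ^ n * (A ^ 2 - B ^ 2))
      by (apply Rmult_le_compat_l; lra).
    lra.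
  - assert (D : B ^ 2 <= A ^ 2) by (assert (0 <= (A - B) * w * Nn) by
      (apply Rmult_le_pos; lra); lra).
    assert (T := pow_diff_ge (A ^ 2) (B ^ 2) n (conj (pow2_ge_0 B) D)).
    (* If [Nn > 0], the cofactor is at least [(A^2)^n], and [A >= B0] exactly from the root of [Lq]
       on. To its left [Lq <= 0], and the minorant is trivial. *)
    destruct (Rle_dec (y / (12 * y - 1)) s) as [G | G].
    + assert (AB0 : B0 <= A).
      { unfold A, B0; replace (/ 12 / (y - / 12)) with (y / (12 * y - 1) / y) by (field; lra).
        apply Rmult_le_compat_r; [apply Rlt_le, Rinv_0_lt_compat; lra | exact G]. }
      assert (T2 : (B0 ^ 2) ^ n <= (A ^ 2) ^ n) by (apply pow_incr; nra).
      assert (T3 : (A ^ 2 - B ^ 2) * (B0 ^ 2) ^ n <= (A ^ 2 - B ^ 2) * (A ^ 2) ^ n)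
        by (apply Rmult_le_compat_l; lra).
      assert (T4 : (B0 ^ 2) ^ n * ((A - B) * w * Lq y s) <= (B0 ^ 2) ^ n * (A ^ 2 - B ^ 2))
        by (apply Rmult_le_compat_l; lra).
      lra.
    + assert (L0 : Lq y s <= 0).
      { rewrite Lq_factor by exact Hy.
        assert (0 <= y * s + (y - / 12)) by nra; nra. }
      assert (T2 : 0 <= (A ^ 2 - B ^ 2) * (A ^ 2) ^ n)
        by (apply Rmult_le_pos; [lra | apply pow_le, pow2_ge_0]).
      assert (T3 : 0 <= (B0 ^ 2) ^ n * - ((A - B) * w * Lq y s)).
      { apply Rmult_le_pos; [lra | ].
        replace (- ((A - B) * w * Lq y s)) with ((A - B) * w * - Lq y s) by ring.
        apply Rmult_le_pos; lra. }
      lra.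
Qed.

Lemma b_3 : b 3 = / 48.
Proof.
  assert (E := b_rec 1); simpl in E; rewrite b2_check, b_1 in E; lra.
Qed.

(** As the mean of [mu] is [1 / 12], the part [y s - y / 12] integrates to zero. What remains is
    [e (y (1/48 - s1/24) - 1/288)], and [s1 <= 1 / 11] for [y > 1] makes it positive. *)
Lemma Lmu_Lq_pos (y : R) : 1 < y -> 0 < Lmu (Lq y).
Proof.
  intros Hy; set (s1 := y / (12 * y - 1)).
  rewrite (Lmu_ext _ (fun s => y * s ^ 2 + ((y - / 12 - y * s1) * s ^ 1 + (- y / 12) * s ^ 0)))
    by (intros; unfold Lq, s1; simpl; field; lra).
  rewrite (Lmu_plus (fun s => y * s ^ 2)
    (fun s => (y - / 12 - y * s1) * s ^ 1 + (- y / 12) * s ^ 0))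
    by (intros; apply ex_derive_continuous_R; auto_derive; auto).
  rewrite (Lmu_plus (fun s => (y - / 12 - y * s1) * s ^ 1) (fun s => (- y / 12) * s ^ 0))
    by (intros; apply ex_derive_continuous_R; auto_derive; auto).
  rewrite (Lmu_scal _ (fun s => s ^ 2)), (Lmu_scal _ (fun s => s ^ 1)), (Lmu_scal _ (fun s => s ^ 0))
    by (intros; apply ex_derive_continuous_R; auto_derive; auto).
  rewrite !Lmu_pow, b_1, b2_check, b_3.
  replace (_ + _) with (exp 1 * (y * (/ 48 - s1 / 24) - / 288)) by field.
  apply Rmult_lt_0_compat; [apply exp_pos | ].
  assert (s1 <= / 11).
  { unfold s1; apply (Rmult_le_reg_r (12 * y - 1)); [lra | ].
    replace (y / (12 * y - 1) * (12 * y - 1)) with y by (field; lra); lra. }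
  nra.
Qed.

(** The upper index [S (2 * n)] means [2 n + 2] terms. Since [y - s > 0] on [[0, 1]], the factor
    [y - s] can be cancelled from the minorant, and [K] is the constant left in front of [Lq]. *)
Lemma Lmu_Dsum_even_pos (y : R) (n : nat) : 1 < y -> 0 < Lmu (Dsum y (y - / 12) (S (2 * n))).
Proof.
  intros Hy.
  set (K := (/ 12 / (y - / 12)) ^ (2 * n) * (/ 12 / (y * (y - / 12)) ^ 2)).
  assert (HK : 0 < K).
  { apply Rmult_lt_0_compat; [apply pow_lt, Rdiv_lt_0_compat; lra | ].
    apply Rdiv_lt_0_compat; [lra | apply pow_lt; nra]. }
  assert (CL : forall s, continuous (Lq y) s)
    by (intros; unfold Lq; apply ex_derive_continuous_R; auto_derive; auto).
  apply Rlt_le_trans with (Lmu (fun s => K * Lq y s)).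
  - rewrite Lmu_scal by exact CL; apply Rmult_lt_0_compat; [exact HK | now apply Lmu_Lq_pos].
  - apply Lmu_le.
    + intros s; apply (continuous_mult (fun _ => K)); [apply continuous_const | apply CL].
    + apply continuous_Dsum.
    + intros s Hs; apply (Rmult_le_reg_l (y - s)); [lra | ].
      rewrite Dsum_eq by exact Hy.
      replace (S (S (2 * n))) with (2 * S n)%nat by lia.
      eapply Rle_trans; [ | now apply even_power_minorant].
      right; unfold K, Rdiv; ring.
Qed.

(** The ratios satisfy [s / y - (s - 1/12) / (y - 1/12) = (y - s) / (12 y (y - 1/12)) >= 0], and odd
    powers preserve order. Strict positivity comes from the atom at [0], where the second ratio is
    negative. *)
Lemma Lmu_Dsum_odd_pos (y : R) (n : nat) : 1 < y -> 0 < Lmu (Dsum y (y - / 12) (2 * n)).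
Proof.
  intros Hy.
  assert (Dp : forall s, 0 <= s <= 1 -> 0 <= Dsum y (y - / 12) (2 * n) s).
  { intros s Hs; apply (Rmult_le_reg_l (y - s)); [lra | ].
    rewrite Rmult_0_r, Dsum_eq by exact Hy.
    assert (A0 : 0 <= s / y) by (apply Rmult_le_pos; [lra | apply Rlt_le, Rinv_0_lt_compat; lra]).
    destruct (Rle_dec (/ 12) s) as [G | G].
    - assert (((s - / 12) / (y - / 12)) ^ S (2 * n) <= (s / y) ^ S (2 * n)); [ | lra].
      apply pow_incr; split.
      + apply Rmult_le_pos; [lra | apply Rlt_le, Rinv_0_lt_compat; lra].
      + assert (E : s / y - (s - / 12) / (y - / 12) = / 12 * (y - s) / (y * (y - / 12)))
          by (field; lra).
        assert (0 <= / 12 * (y - s) / (y * (y - / 12)))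
          by (apply Rmult_le_pos; [ | apply Rlt_le, Rinv_0_lt_compat]; nra).
        lra.
    - assert (H1 := pow_le _ (S (2 * n)) A0).
      assert (H2 : 0 <= - ((s - / 12) / (y - / 12))).
      { replace (- ((s - / 12) / (y - / 12))) with ((/ 12 - s) / (y - / 12)) by (field; lra).
        apply Rmult_le_pos; [lra | apply Rlt_le, Rinv_0_lt_compat; lra]. }
      set (B := (s - / 12) / (y - / 12)) in *.
      assert (H3 : 0 <= (B ^ 2) ^ n) by apply pow_le, pow2_ge_0.
      assert (B ^ S (2 * n) = B * (B ^ 2) ^ n) by (rewrite <- pow_mult; reflexivity).
      nra. }
  assert (D0 : 0 < Dsum y (y - / 12) (2 * n) 0).
  { apply (Rmult_lt_reg_l y); [lra | rewrite Rmult_0_r].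
    assert (E := Dsum_eq y 0 (2 * n) Hy); rewrite Rminus_0_r in E; rewrite E.
    set (B := (0 - / 12) / (y - / 12)).
    assert (HB : 0 < - B).
    { unfold B; replace (- ((0 - / 12) / (y - / 12))) with (/ 12 / (y - / 12)) by (field; lra).
      apply Rdiv_lt_0_compat; lra. }
    assert (B ^ S (2 * n) = B * (B ^ 2) ^ n) by (rewrite <- pow_mult; reflexivity).
    assert (0 < (B ^ 2) ^ n) by (apply pow_lt; nra).
    replace (0 / y) with 0 by (field; lra).
    rewrite pow_i by lia; nra. }
  unfold Lmu.
  assert (0 <= RInt (fun s => gs s * Dsum y (y - / 12) (2 * n) s) 0 1); [ | lra].
  apply RInt_ge_0; [lra | apply ex_RInt_gs, continuous_Dsum | ].
  intros s Hs; apply Rmult_le_pos; [now apply gs_pos | apply Dp; lra].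
Qed.

Theorem theorem2 : forall (m : nat) (x : R),
  (1 <= m)%nat -> 0 < x -> S_m m x > sigma_m m x.
Proof.
  intros m x Hm Hx; destruct m as [ | N]; [lia | ].
  assert (P : 0 < Lmu (Dsum (1 + x) (x + 11 / 12) N)).
  { replace (x + 11 / 12) with (1 + x - / 12) by field.
    (* Here [m = S N], so an even [N] is the case of odd [m]. *)
    destruct (Nat.Even_or_Odd N) as [[n ->] | [n ->]].
    - apply Lmu_Dsum_odd_pos; lra.
    - rewrite Nat.add_1_r; apply Lmu_Dsum_even_pos; lra. }
  rewrite Lmu_Dsum in P.
  assert (E := exp_pos 1); nra.
Qed.
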